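(* Let $\mathcal{A}$ be a weakly block-stable class of graphs, and let $R_n$ be uniformly distributed on $\mathcal{A}_n$. Then: (i) with high probability the block forest $\mathrm{BF}(R_n)$ has diameter at most $5\sqrt{n\log n}$; (ii) for each $\varepsilon>0$ the probability that $\mathrm{BF}(R_n)$ has diameter at least $\varepsilon n$ is $e^{-\Omega(n)}$, where the function $\Omega(n)$ does not depend on the class $\mathcal{A}$; that is, for each $\varepsilon>0$ there are $\delta>0$ and $n_0$, depending only on $\varepsilon$, such that for every weakly block-stable class $\mathcal{A}$ and every $n\ge n_0$ with $\mathcal{A}_n\ne\emptyset$, $\mathbb{P}(\mathrm{BF}(R_n)\text{ has diameter at least }\varepsilon n)\le e^{-\delta n}$; (iii) if for each $n$ every graph in $\mathcal{A}_n$ has at most $k=k(n)$ blocks, where $k(n)\to\infty$ as $n\to\infty$, then with high probability the block forest $\mathrm{BF}(R_n)$ has diameter at most $5\sqrt{k\log k}$.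
   Context: All graphs are finite and simple; a class of graphs is always closed under isomorphism. A block of a graph is a maximal 2-connected subgraph, or the subgraph formed by a bridge (an edge whose deletion increases the number of components), or by an isolated vertex. Equivalence relation $\sim$: for connected graphs $G,H$, write $G\sim H$ if they have the same vertex set and, for each isomorphism type of graph, the same number of blocks of that type. For general graphs, $G\sim H$ if the components can be listed as $G_1,\dots,G_k$ and $H_1,\dots,H_k$ (for some $k$) with $G_i\sim H_i$ for each $i$. A class $\mathcal{A}$ of graphs is weakly block-stable if whenever $G\in\mathcal{A}$ and $H\sim G$ then $H\in\mathcal{A}$. $[n]=\{1,\dots,n\}$; for a class $\mathcal{A}$, $\mathcal{A}_n$ is the set of graphs in $\mathcal{A}$ with vertex set $[n]$. Only integers $n$ for which $\mathcal{A}_n$ is non-empty are considered, and limits $n\to\infty$ are along such $n$. Events $E_n$ hold with high probability if $\mathbb{P}(E_n)\to1$ as $n\to\infty$. The block tree $\mathrm{BT}(G)$ of a connected graph $G$ is the bipartite graph with a node $x_v$ for each vertex $v$ of $G$ and a node $y_B$ for each block $B$ of $G$, where $x_v$ and $y_B$ are adjacent if and only if $v\in B$. For a general graph $G$, the block forest $\mathrm{BF}(G)$ is the disjoint union of the block trees of the components of $G$. The diameter of a graph is the maximum distance between any two vertices in the same component. *)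

(* Defs.v *)
From HB Require Import structures.
From mathcomp Require Import all_boot all_order all_algebra.
From mathcomp Require Import all_classical all_reals all_analysis.

Set Implicit Arguments.
Unset Strict Implicit.
Unset Printing Implicit Defensive.

Import Order.TTheory GRing.Theory Num.Theory.
Import numFieldNormedType.Exports.

(* A graph T is a finite simple graph whose vertex set is an arbitrary subset
   of T, so that a graph and its subgraphs have the same Rocq type.  The data is
   the pair (vertex set, edge set), edges being 2-element sets of vertices. *)
Definition wf_graph (T : finType) (VE : {set T} * {set {set T}}) : bool :=
  [forall e in VE.2, (#|e| == 2) && (e \subset VE.1)].

Record graph (T : finType) := Graph {
  graph_data : {set T} * {set {set T}};
  graph_wf : wf_graph graph_data }.

HB.instance Definition _ (T : finType) := [isSub for @graph_data T].
HB.instance Definition _ (T : finType) := [Finite of graph T by <:].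

Definition vset (T : finType) (G : graph T) : {set T} := (graph_data G).1.
Definition eset (T : finType) (G : graph T) : {set {set T}} := (graph_data G).2.

Lemma mkgraph_wf (T : finType) (V : {set T}) (E : {set {set T}}) :
  wf_graph (V, [set e in E | (#|e| == 2) && (e \subset V)]).
Proof. by apply/forall_inP => e; rewrite inE => /andP[]. Qed.

(* Members of E that are not 2-element subsets of V are dropped. *)
Definition mkgraph (T : finType) (V : {set T}) (E : {set {set T}}) : graph T :=
  Graph (mkgraph_wf V E).

Definition adj (T : finType) (G : graph T) : rel T :=
  fun x y => [set x; y] \in eset G.

Definition graph_iso (T U : finType) (G : graph T) (H : graph U) : Prop :=
  exists2 f : {x : T | x \in vset G} -> {y : U | y \in vset H},
    bijective f & forall x y, adj G (val x) (val y) = adj H (val (f x)) (val (f y)).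

Definition subgraph (T : finType) (H G : graph T) : bool :=
  (vset H \subset vset G) && (eset H \subset eset G).

Definition maximal_subgraph (T : finType) (P : pred (graph T)) (G H : graph T) : bool :=
  [&& subgraph H G, P H &
      [forall K : graph T, [&& subgraph K G, P K & subgraph H K] ==> (K == H)]].

(* The empty graph is not connected: it has no component. *)
Definition connected_graph (T : finType) (G : graph T) : bool :=
  (vset G != finset.set0) &&
  [forall x in vset G, forall y in vset G, connect (adj G) x y].

Definition components (T : finType) (G : graph T) : {set graph T} :=
  [set C | maximal_subgraph (@connected_graph T) G C].

Definition del_vertex (T : finType) (G : graph T) (x : T) : graph T :=
  mkgraph (vset G :\ x) (eset G).

Definition del_edge (T : finType) (G : graph T) (e : {set T}) : graph T :=
  mkgraph (vset G) (eset G :\ e).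

Definition two_connected (T : finType) (G : graph T) : bool :=
  [&& 3 <= #|vset G|, connected_graph G &
      [forall x in vset G, connected_graph (del_vertex G x)]].

Definition bridge (T : finType) (G : graph T) (e : {set T}) : bool :=
  (e \in eset G) && (#|components G| < #|components (del_edge G e)|).

Definition isolated (T : finType) (G : graph T) (x : T) : bool :=
  (x \in vset G) && [forall y, ~~ adj G x y].

Definition blocks (T : finType) (G : graph T) : {set graph T} :=
  [set B | [|| maximal_subgraph (@two_connected T) G B,
               [exists e, bridge G e && (B == mkgraph e [set e])] |
               [exists x, isolated G x && (B == mkgraph [set x] finset.set0)]]].

(* The isomorphism type of a graph is given by any representative K. *)
Definition sim_connected (T : finType) (G H : graph T) : Prop :=
  vset G = vset H /\
  forall (U : finType) (K : graph U),
    #|[set B in blocks G | `[< graph_iso B K >]]| =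
    #|[set B in blocks H | `[< graph_iso B K >]]|.

Definition sim (T : finType) (G H : graph T) : Prop :=
  exists (k : nat) (C D : 'I_k -> graph T),
    [/\ injective C, [set C i | i : 'I_k] = components G,
        injective D, [set D i | i : 'I_k] = components H
      & forall i, sim_connected (C i) (D i)].

Record graph_class := GraphClass {
  in_class :> forall T : finType, graph T -> Prop;
  in_class_iso : forall (T U : finType) (G : graph T) (H : graph U),
    graph_iso G H -> in_class G -> in_class H }.

Definition weakly_block_stable (A : graph_class) : Prop :=
  forall (T : finType) (G H : graph T), A T G -> sim H G -> A T H.

(* A_n, with vertex set 'I_n = {0, ..., n-1} in place of {1, ..., n}. *)
Definition graphs_on (A : graph_class) (n : nat) : {set graph 'I_n} :=
  [set G : graph 'I_n | (vset G == [set: 'I_n]) && `[< A 'I_n G >]].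

(* Nodes: inl v is x_v and inr B is y_B. *)
Definition block_tree (T : finType) (G : graph T) : graph (T + graph T)%type :=
  mkgraph ([set inl v | v in vset G] :|: [set inr B | B in blocks G])
          [set [set inl v; inr B] | v in vset G, B in blocks G & v \in vset B].

(* The block trees of distinct components have disjoint node sets, so that this
   union is a disjoint union. *)
Definition block_forest (T : finType) (G : graph T) : graph (T + graph T)%type :=
  mkgraph (\bigcup_(C in components G) vset (block_tree C))
          (\bigcup_(C in components G) eset (block_tree C)).

Definition has_walk (T : finType) (G : graph T) (x y : T) (k : nat) : bool :=
  [exists p : k.-tuple T, path (adj G) x p && (last x p == y)].

(* Some shortest walk has length less than #|T| if there is a walk at all;
   otherwise the value is #|T|. *)
Definition dist (T : finType) (G : graph T) (x y : T) : nat :=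
  \big[minn/#|T|]_(k < #|T| | has_walk G x y k) k.

Definition diam (T : finType) (G : graph T) : nat :=
  \max_(C in components G) \max_(x in vset C) \max_(y in vset C) dist G x y.

Local Open Scope ring_scope.

Definition unif_pr (R : realType) (X : finType) (S : {set X}) (P : X -> Prop) : R :=
  #|[set x in S | `[< P x >]]|%:R / #|S|%:R.

(* Probability that R_n, uniformly distributed on A_n, satisfies E. *)
Definition class_pr (R : realType) (A : graph_class) (n : nat)
  (E : graph 'I_n -> Prop) : R := unif_pr R (graphs_on A n) E.

Local Open Scope classical_set_scope.

(* n tends to infinity along the n such that A_n is nonempty. *)
Definition class_infty (A : graph_class) : set_system nat :=
  within (fun n => graphs_on A n != finset.set0) \oo.

Definition whp (R : realType) (A : graph_class)
  (E : forall n, graph 'I_n -> Prop) : Prop :=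
  (fun n => class_pr R A (E n)) @ class_infty A --> (1 : R).

(* Main.v *)
Require Import Defs.
From mathcomp Require Import all_boot.
From mathcomp Require Import boolp zify.

(* Root each component at a vertex [r].  Re-attaching at [r] everything that
   another vertex separates from [r] turns a connected graph into a flat one,
   all of whose blocks contain [r]; conversely a graph is recovered from its flat
   graph [H] and an acyclic function sending each component ("body") of [H - r]
   to the vertex at which it hangs.  All acyclic functions give graphs with the
   same blocks, so a class closed under [sim] splits into fibres, each of which
   is the set of all acyclic functions of some [H].  In a uniform acyclic
   function the two root paths of two bodies are exposed step by step: each step
   picks a vertex uniformly, and the exposed bodies form one merged body, so
   that paths with [m + 2] bodies in total have probability at most [m + 2] times
   the probability that [m] independent draws from the [k] bodies are distinct.
   By Maclaurin's inequality the latter is at most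
   [k (k - 1) ... (k - m + 1) / k ^ m <= exp (- m (m - 1) / (2 k))], and a union
   bound over the [k ^ 2] pairs of bodies suffices for the constant [5]. *)

(** Bodies have different sizes, so the draws are weighted; Maclaurin's inequality makes equal
    weights the worst case, and only the number of bodies survives in the bound. Exposure glues
    bodies together, so the counting is done for abstractly labelled vertices, where gluing is a
    mere relabelling. The factor [m + 2] records the step at which the first path reaches the root.

    A disconnected graph is handled one component at a time: with the rest of the graph and the
    vertex set of the component frozen, the possible components form a set closed under
    [sim_connected]. The bounds for components with [k_i] blocks are added, and the sum of the
    [k_i ^ 2] is at most the square of the sum of the [k_i].

    A union of at most [m + 1] bodies gives distance at most [2 m + 4] in the block tree. Thus [m]
    is about [(5/2) sqrt (k log k)], and [m ^ 2 / (2 k)] is about [(25/8) log k]. The prefactor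
    [(m + 2) k ^ 2] is at most a constant times [k ^ 3], which leaves [k ^ (-1/8)] up to a
    constant. *)

Set Implicit Arguments.
Unset Strict Implicit.
Unset Printing Implicit Defensive.

(** * Counting acyclic functions *)

(* [m`!] times the [m]-th elementary symmetric polynomial in the [w z], [z \in D]. *)
Fixpoint esum (I : finType) (w : I -> nat) (m : nat) (D : {set I}) : nat :=
  if m is m'.+1 then \sum_(z in D) w z * esum w m' (D :\ z) else 1.

Lemma in_sep (X : finType) (A : {set X}) (Q : pred X) x :
  (x \in [set y in A | Q y]) = (x \in A) && Q x.
Proof. by rewrite inE. Qed.

Section Esum.
Variable I : finType.
Implicit Types (w : I -> nat) (D : {set I}).

Lemma eq_esum w w' m D : {in D, w =1 w'} -> esum w m D = esum w' m D.
Proof.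
elim: m D => [|m IH] D eqw //=; apply: eq_bigr => z zD.
by rewrite eqw // IH // => t /setD1P[_ tD]; apply: eqw.
Qed.

Lemma leq_esum w m D D' : D \subset D' -> esum w m D <= esum w m D'.
Proof.
elim: m D D' => [|m IH] D D' sDD' //=.
apply: (@leq_trans (\sum_(z in D) w z * esum w m (D' :\ z))).
  by apply: leq_sum => z _; rewrite leq_mul2l IH ?orbT // setSD.
rewrite [leqRHS](big_setID D) /= (setIidPr sDD'); exact: leq_addr.
Qed.

(** [esum] sums over ordered choices of distinct elements: [z] is either absent or sits in one of
    [m + 1] positions. *)
Lemma esum_setD1 w m D z : z \in D ->
  esum w m.+1 D = esum w m.+1 (D :\ z) + m.+1 * w z * esum w m (D :\ z).
Proof.
elim: m D z => [|m IH] D z zD.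
  by rewrite /= (big_setD1 z) //= addnC mul1n.
have stepE t : t \in D :\ z -> w t * esum w m.+1 (D :\ t) =
    w t * esum w m.+1 (D :\ z :\ t) + m.+1 * w z * (w t * esum w m (D :\ z :\ t)).
  move=> /setD1P[tz tD].
  rewrite (IH (D :\ t) z); last by rewrite !inE eq_sym tz zD.
  rewrite setDDl setUC -setDDl; lia.
have -> : esum w m.+2 D = \sum_(t in D) w t * esum w m.+1 (D :\ t) by [].
rewrite (big_setD1 z) //= (eq_bigr _ stepE) big_split /= -big_distrr /=.
lia.
Qed.

(** Chebyshev's sum inequality: [(w z - w t) (q z - q t) >= 0], summed over all pairs. *)
Lemma chebyshev_sum (D : {set I}) (w q : I -> nat) :
  {in D &, forall z t, w z <= w t -> q z <= q t} ->
  (\sum_(z in D) w z) * (\sum_(z in D) q z) <= #|D| * \sum_(z in D) w z * q z.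
Proof.
move=> mono.
have E1 : #|D| * \sum_(z in D) w z * q z =
    \sum_(z in D) \sum_(t in D) w z * q z.
  rewrite big_distrr /=; apply: eq_bigr => z _.
  by rewrite sum_nat_const.
have E2 : #|D| * \sum_(z in D) w z * q z =
    \sum_(z in D) \sum_(t in D) w t * q t.
  by rewrite sum_nat_const.
have E3 : (\sum_(z in D) w z) * (\sum_(z in D) q z) =
    \sum_(z in D) \sum_(t in D) w z * q t.
  by rewrite big_distrl /=; apply: eq_bigr => z _; rewrite big_distrr.
have E4 : (\sum_(z in D) w z) * (\sum_(z in D) q z) =
    \sum_(z in D) \sum_(t in D) w t * q z.
  by rewrite E3 exchange_big.
have: \sum_(z in D) \sum_(t in D) (w z * q t + w t * q z) <=
    \sum_(z in D) \sum_(t in D) (w z * q z + w t * q t).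
  apply: leq_sum => z zD; apply: leq_sum => t tD.
  case/orP: (leq_total (w z) (w t)) => le_w;
    have le_q := mono _ _ _ _ le_w; [have := le_q zD tD | have := le_q tD zD]; nia.
under eq_bigr do rewrite big_split /=.
under [X in _ <= X -> _]eq_bigr do rewrite big_split /=.
rewrite !big_split /= -E3 -E4 -E1 -E2; lia.
Qed.

(** Chebyshev's inequality is applied to the weights and to the share of [esum w m D] whose first
    element is [z]. The term with factor [m] stands on the left to avoid truncated subtraction. *)
Lemma esum_newton w m D :
  #|D| * esum w m.+1 D + m * (\sum_(z in D) w z) * esum w m D <=
  #|D| * (\sum_(z in D) w z) * esum w m D.
Proof.
case: m => [|m]; first by rewrite /= mul0n addn0 !muln1; under eq_bigr do rewrite muln1.
(* Multiplying by the total weight appends one more element [z], either new or equal to one of the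
   [m + 1] chosen ones. *)
have E1 : (\sum_(z in D) w z) * esum w m.+1 D =
    esum w m.+2 D + m.+1 * \sum_(z in D) w z * (w z * esum w m (D :\ z)).
  have -> : esum w m.+2 D = \sum_(z in D) w z * esum w m.+1 (D :\ z) by [].
  rewrite big_distrl big_distrr -big_split; apply: eq_bigr => z zD.
  rewrite (esum_setD1 w m zD); move: (esum _ m.+1 _) (esum _ m _) => a c /=; lia.
(* Expanding each side along the other element leaves the same cross term and sums over the same set
   [D :\ z :\ t], so only [w z <= w t] is compared. *)
have mono : {in D &, forall z t, w z <= w t ->
    w z * esum w m (D :\ z) <= w t * esum w m (D :\ t)}.
  move=> z t zD tD le_w; have [->//|zt] := eqVneq z t.
  have tDz : t \in D :\ z by rewrite !inE eq_sym zt.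
  have zDt : z \in D :\ t by rewrite !inE zt.
  case: m {E1} => [|m]; first by rewrite /= !muln1.
  rewrite (esum_setD1 w m tDz) (esum_setD1 w m zDt) !setDDl [[set t; z]]setUC; nia.
have := chebyshev_sum mono.
have -> : \sum_(z in D) w z * esum w m (D :\ z) = esum w m.+1 D by [].
set S := \sum_(z in D) w z * (_ * _) in E1 *; set W := \sum_(z in D) w z in E1 *.
set e1 := esum w m.+1 D in E1 *; set e2 := esum w m.+2 D in E1 *.
move=> che.
rewrite -!mulnA {2}E1 mulnDr leq_add2l [leqRHS]mulnCA leq_mul2l; exact: che.
Qed.

Lemma esum_maclaurin w m D :
  #|D| ^ m * esum w m D <= #|D| ^_ m * (\sum_(z in D) w z) ^ m.
Proof.
elim: m => [|m IH]; first by rewrite /= ffactn0.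
have := esum_newton w m D.
move: IH; rewrite ffactnSr !expnSr.
set k := #|D|; set e1 := esum w m.+1 D; set e := esum w m D; set W := \sum_(z in D) w z.
move=> IH newton.
apply: (@leq_trans ((k - m) * W * (k ^ m * e))).
  have: k * e1 <= (k - m) * W * e by rewrite mulnBl mulnBl leq_subRL; lia.
  by move=> H; have := leq_mul (leqnn (k ^ m)) H; lia.
have := leq_mul (leqnn ((k - m) * W)) IH; lia.
Qed.
End Esum.

(** * Exposure of root paths in acyclic functions *)

Section AcyclicFamilies.
Variables (V I : finType) (o : I) (Vs : {set V}).
Implicit Types (b : V -> I) (D : {set I}) (p q : {ffun I -> V}) (x y z i j : I).

Definition pstep b p i : I := if i == o then o else b (p i).

(* [b] labels the vertices, [o] being the label of the root class; [p] sends each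
   label of [D] to a vertex, and its values outside [D] are fixed by [q]. *)
Definition acyc_fam b D q : {set {ffun I -> V}} :=
  [set p : {ffun I -> V} | [forall i, if i \in D then p i \in Vs else p i == q i] &&
           [forall i in D, fconnect (pstep b p) i o]].

(** The labels on the root path of [i], with [i] and without [o]. *)
Definition anc b p i : {set I} := [set j | fconnect (pstep b p) i j] :\ o.

Definition labelling b D : Prop :=
  o \notin D /\ {in Vs, forall v, b v \in o |: D}.

(* Once [p x] is known to be labelled [y], the class of [x] joins that of [y];
   the remaining values of [p] are then acyclic for the merged labels. *)
Definition merge b x y : V -> I := fun v => if b v == x then y else b v.

Definition upd q x v : {ffun I -> V} := [ffun i => if i == x then v else q i].

Definition weight b z : nat := #|[set v in Vs | b v == z]|.

(** A visit to [x] is bypassed: the step into [x] now lands directly on [b (p x)]. The induction is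
    strong because a bypass consumes two steps. *)
Lemma merge_connect b p x i j : x != o -> b (p x) != x -> i != x -> j != x ->
  fconnect (pstep b p) i j -> fconnect (pstep (merge b x (b (p x))) p) i j.
Proof.
move=> xo yx ix jx /iter_findex; move: (findex _ i j) => m.
elim/ltn_ind: m i ix => -[_|m IH] i ix; first by move=> <-.
have [io|io] := eqVneq i o.
  have fixo k : iter k (pstep b p) o = o.
    by elim: k => //= k ->; rewrite /pstep eqxx.
  by rewrite io fixo => ->; exact: connect0.
rewrite iterSr => ij; apply: connect_trans (fconnect1 _ _) _.
have stepE : pstep b p i = b (p i) by rewrite /pstep (negPf io).
rewrite [X in connect _ X _]/pstep (negPf io) /merge.
move: ij; rewrite stepE; case: eqP => [-> |/eqP nx ij]; last exact: (IH m).
case: m IH => [|m] IH; first by move=> /= xj; rewrite xj eqxx in jx.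
rewrite iterSr {2}/pstep (negPf xo) => ij.
by apply: (IH m) => //; rewrite ltnS ltnW.
Qed.

Lemma acyc_famP b D q p : reflect
  [/\ {in D, forall i, p i \in Vs}, forall i, i \notin D -> p i = q i &
      {in D, forall i, fconnect (pstep b p) i o}] (p \in acyc_fam b D q).
Proof.
rewrite inE; apply: (iffP andP) => [[/forallP vals /forall_inP acyc]|[pV pq acyc]].
  split=> // i => [iD|/negPf iD]; have := vals i; rewrite iD => // /eqP //.
split; last exact/forall_inP.
by apply/forallP => i; case: ifPn => [/pV//|/pq->].
Qed.

Lemma acyc_fam_neq b D q p x : labelling b D -> p \in acyc_fam b D q -> x \in D ->
  b (p x) != x.
Proof.
move=> [oD _] /acyc_famP[_ _ acyc] xD; apply/negP => /eqP bx.
have xo : x != o by apply: contraNneq oD => <-.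
have fixx k : iter k (pstep b p) x = x by elim: k => //= k ->; rewrite /pstep (negPf xo).
by have /iter_findex := acyc x xD; rewrite fixx => xo'; rewrite xo' eqxx in xo.
Qed.

Lemma labelling_merge b D x v : labelling b D -> x \in D -> v \in Vs -> b v != x ->
  labelling (merge b x (b v)) (D :\ x).
Proof.
move=> [oD bD] xD vV bvx; split; first by rewrite !inE negb_and oD orbT.
move=> u uV; rewrite /merge; have := bD u uV; have := bD v vV; rewrite !inE.
by case: (eqVneq (b u) x) => [_|->]; rewrite ?bvx.
Qed.

(** The exposure step: root paths survive the gluing in both directions, so conditioning on
    [p x = v] gives a family of the same kind with one free label less. *)
Lemma acyc_fam_merge b D q x v : labelling b D -> x \in D -> v \in Vs -> b v != x ->
  [set p in acyc_fam b D q | p x == v] =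
  acyc_fam (merge b x (b v)) (D :\ x) (upd q x v).
Proof.
move=> lab xD vV bvx; have [oD bD] := lab.
have xo : x != o by apply: contraNneq oD => <-.
apply/setP => p; rewrite inE; apply/andP/idP => [[/acyc_famP[pV pq acyc] /eqP px]|].
  apply/acyc_famP; split => [i /setD1P[_]|i|i /setD1P[ix iD]]; first exact: pV.
    rewrite !inE negb_and negbK ffunE; case: eqP => [->//|_] /=; exact: pq.
  by rewrite -px; apply: merge_connect; rewrite ?px // 1?eq_sym ?acyc.
move=> /acyc_famP[pV pq acyc].
have px : p x = v by rewrite pq ?inE ?eqxx // ffunE eqxx.
have back i : fconnect (pstep (merge b x (b v)) p) i o -> fconnect (pstep b p) i o.
  apply: connect_sub => j k /eqP <-; rewrite [pstep (merge _ _ _) p j]/pstep /merge.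
  case: eqVneq => [->|jo]; first exact: connect0.
  have sj : pstep b p j = b (p j) by rewrite /pstep (negPf jo).
  case: eqP => [pj|_]; last by rewrite -sj fconnect1.
  apply: connect_trans (fconnect1 _ j) _; rewrite sj pj -px.
  have -> : b (p x) = pstep b p x by rewrite /pstep (negPf xo).
  exact: fconnect1.
have acycD i : i \in D -> i != x -> fconnect (pstep b p) i o.
  by move=> iD ix; apply/back/acyc; rewrite !inE ix.
split; last by rewrite px.
apply/acyc_famP; split => [i iD|i iD|i iD].
- by have [->|ix] := eqVneq i x; [rewrite px|apply: pV; rewrite !inE ix].
- rewrite pq ?inE ?(negPf iD) ?andbF // ffunE; case: eqP => // ix.
  by rewrite ix xD in iD.
- have [->|] := eqVneq i x; last exact: acycD.
  apply: connect_trans (fconnect1 _ x) _; rewrite [pstep b p x]/pstep (negPf xo) px.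
  have := bD v vV; rewrite !inE; case/predU1P => [->|bvD]; first exact: connect0.
  exact: acycD.
Qed.

Lemma card_acyc_fam_split b D q x (Q : pred {ffun I -> V}) :
  labelling b D -> x \in D ->
  #|[set p in acyc_fam b D q | Q p]| =
  \sum_(v in Vs | b v != x)
     #|[set p in acyc_fam (merge b x (b v)) (D :\ x) (upd q x v) | Q p]|.
Proof.
move=> lab xD; rewrite -sum1_card.
rewrite (partition_big (fun p : {ffun I -> V} => p x) (fun v => (v \in Vs) && (b v != x))).
  apply: eq_bigr => v /andP[vV bvx]; rewrite sum1_card -acyc_fam_merge //.
  by apply: eq_card => p; rewrite [LHS]unfold_in /= !in_set andbAC.
move=> p; rewrite inE => /andP[pF _]; rewrite (acyc_fam_neq lab pF xD) andbT.
by have /acyc_famP[-> ] := pF.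
Qed.

Lemma weight_merge b x y z : x != z -> y != z -> weight (merge b x y) z = weight b z.
Proof.
move=> xz yz; apply: eq_card => v; rewrite !inE /merge; congr (_ && _).
by case: (b v =P x) => // ->; rewrite (negPf yz) (negPf xz).
Qed.

Lemma weight_merge_id b x y : x != y -> weight (merge b x y) y = weight b x + weight b y.
Proof.
move=> xy; rewrite /weight -cardsUI.
have -> : [set v in Vs | b v == x] :&: [set v in Vs | b v == y] = set0.
  by apply/setP => v; rewrite !inE; case: eqP => [->|]; rewrite ?(negPf xy) !andbF.
rewrite cards0 addn0; apply: eq_card => v; rewrite !inE /merge -andb_orr; congr (_ && _).
by case: (b v =P x) => // _; rewrite eqxx.
Qed.

(* A weighted Cayley formula. *)
Lemma card_acyc_fam b D q : labelling b D ->
  #|Vs| * #|acyc_fam b D q| = weight b o * #|Vs| ^ #|D|.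
Proof.
move Dk: #|D| => k; elim: k b D q Dk => [|k IH] b D q Dk lab.
  have D0 : D = set0 by apply/eqP; rewrite -cards_eq0 Dk.
  have -> : acyc_fam b D q = [set q].
    apply/setP => p; rewrite in_set1; apply/acyc_famP/eqP => [[_ pq _]|->].
      by apply/ffunP => i; rewrite pq // D0 inE.
    by split => // i; rewrite D0 inE.
  rewrite cards1 muln1 expn0 muln1; apply: eq_card => v; rewrite inE.
  case: (boolP (v \in Vs)) => //= vV; have [_ /(_ v vV)] := lab.
  by rewrite D0 setU0 inE => ->.
have /card_gt0P[x xD] : 0 < #|D| by rewrite Dk.
have xo : x != o by case: lab => oD _; apply: contraNneq oD => <-.
have kE : #|D :\ x| = k by move: Dk; rewrite (cardsD1 x) xD => -[].
have := card_acyc_fam_split q predT lab xD.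
have idT (A : {set {ffun I -> V}}) : [set p in A | predT p] = A.
  by apply/setP => p; rewrite inE andbT.
rewrite idT; under eq_bigr do rewrite idT.
move=> ->; rewrite big_distrr /=.
under eq_bigr => v /andP[vV bvx] do rewrite (IH _ _ _ kE (labelling_merge lab xD vV bvx)).
rewrite -big_distrl /= expnS mulnA; congr (_ * _).
(* The root class grows only if [v] lies in it, so the new root weights sum to
   [w_o (|Vs| - w_x) + w_o w_x = w_o |Vs|]. *)
have wE v : v \in Vs -> b v != x ->
    weight (merge b x (b v)) o = weight b o + (b v == o) * weight b x.
  move=> vV bvx; have [bo|bo] := eqVneq (b v) o.
    by rewrite bo weight_merge_id // mul1n addnC.
  by rewrite weight_merge // mul0n addn0.
under eq_bigr => v /andP[vV bvx] do rewrite (wE v vV bvx).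
have -> : #|Vs| = weight b x + #|[set v in Vs | b v != x]|.
  rewrite -(cardsID [set v | b v == x] Vs); congr (_ + _);
  by apply: eq_card => v; rewrite !inE // andbC.
rewrite big_split /= sum_nat_cond_const -big_distrl /= mulnDr addnC mulnC.
congr (_ + _); last by rewrite mulnC; congr (_ * _); apply: eq_card => v; rewrite !inE.
rewrite [RHS]mulnC; congr (_ * _); transitivity (\sum_(v in Vs | b v != x) (if b v == o then 1 else 0)).
  by apply: eq_bigr => v _; case: (b v == o).
rewrite -big_mkcondr sum1_card; apply: eq_card => v; rewrite !inE unfold_in /= -andbA.
by congr (_ && _); case: (b v =P o) => [->|]; rewrite ?andbF ?andbT // eq_sym xo.
Qed.

Lemma anc_root b p : anc b p o = set0.
Proof.
apply/setP => j; rewrite !inE; apply/negP => /andP[jo /iter_findex].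
have fixo k : iter k (pstep b p) o = o by elim: k => //= k ->; rewrite /pstep eqxx.
by rewrite fixo => oj; rewrite oj eqxx in jo.
Qed.

(** Exposing [x] removes at most the label [x] from a root path, and the path of [x] itself
    continues from [b (p x)]. *)
Lemma anc_merge b p x i : x != o -> b (p x) != x ->
  anc b p i \subset x |: anc (merge b x (b (p x))) p (if i == x then b (p x) else i).
Proof.
move=> xo bpx; apply/subsetP => j; rewrite !inE => /andP[-> ij] /=.
have [//|jx] := eqVneq j x; rewrite /=.
case: eqVneq ij => [->|ix]; last exact: merge_connect.
case/connectP => -[/= _ jx'|k pth]; first by rewrite jx' eqxx in jx.
have -> : path (frel (pstep b p)) x (k :: pth) =
    (b (p x) == k) && path (frel (pstep b p)) k pth by rewrite /= /pstep (negPf xo).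
move=> /andP[/eqP <- pth'] jl; apply: merge_connect => //.
by apply/connectP; exists pth.
Qed.

Lemma acyc_fam_merge_val b D q x v p : x \in D ->
  p \in acyc_fam (merge b x (b v)) (D :\ x) (upd q x v) -> p x = v.
Proof.
by move=> xD /acyc_famP[_ pq _]; rewrite pq ?setD11 // ffunE eqxx.
Qed.

Lemma labelling_neq_root b D x : labelling b D -> x \in D -> x != o.
Proof. by move=> [oD _] xD; apply: contraNneq oD => <-. Qed.

Lemma labelling_root b D x v : labelling b D -> v \in Vs -> b v != x ->
  b v \notin D :\ x -> b v = o.
Proof.
move=> [_ bD] vV bvx; have := bD v vV; rewrite !inE bvx /=.
by case/predU1P => // ->.
Qed.

(** Labels not yet visited keep their original weights, which is why the successive draws multiply
    up to [esum]. *)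
Lemma eq_esum_merge b D x y m : x \notin D -> y \notin D ->
  esum (weight (merge b x y)) m D = esum (weight b) m D.
Proof.
move=> xD yD; apply: eq_esum => z zD; apply: weight_merge.
  by apply: contraNneq xD => ->.
by apply: contraNneq yD => ->.
Qed.

Lemma sum_labels b D x (f : I -> nat) : labelling b D -> x \in D -> f o = 0 ->
  \sum_(v in Vs | b v != x) f (b v) = \sum_(z in D :\ x) weight b z * f z.
Proof.
move=> lab xD fo.
rewrite (bigID (fun v => b v \in D :\ x)) /= addnC big1 ?add0n; last first.
  by move=> v /andP[/andP[vV bvx]] /(labelling_root lab vV bvx) ->.
rewrite (partition_big b (mem (D :\ x))) /=; last by move=> v /andP[].
apply: eq_bigr => z zD; rewrite (eq_bigr (fun=> f z)); last first.
  by move=> v /andP[_ /eqP ->].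
rewrite sum_nat_cond_const; congr (_ * _); apply: eq_card => v; rewrite !inE unfold_in /=.
case: (b v =P z) => [->|_]; last by rewrite !andbF.
by move: (zD); rewrite !andbT => /setD1P[-> ->]; rewrite !andbT.
Qed.

(** To last, the path must hit a new label [z], as [weight b z] vertices do, and it continues from
    the merged class; the labels hit are distinct, whence [esum]. Together with [card_acyc_fam] this
    bounds the probability by [esum (weight b) m (D :\ x) / |Vs| ^ m]. *)
Lemma card_anc_ge b D q x m : labelling b D -> x \in D ->
  #|[set p in acyc_fam b D q | m < #|anc b p x|]| * #|Vs| ^ m.+1 <=
  weight b o * #|Vs| ^ #|D| * esum (weight b) m (D :\ x).
Proof.
elim: m b D q x => [|m IH] b D q x lab xD.
  rewrite expn1 muln1 -(card_acyc_fam q lab) mulnC leq_mul2l; apply/orP; right.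
  by apply: subset_leq_card; apply/subsetP => p; rewrite in_sep => /andP[].
have xo := labelling_neq_root lab xD.
rewrite (card_acyc_fam_split q _ lab xD) big_distrl /=.
pose f z := if z \in D :\ x then
  weight b o * #|Vs| ^ #|D| * esum (weight b) m (D :\ x :\ z) else 0.
apply: (@leq_trans (\sum_(v in Vs | b v != x) f (b v))); last first.
  rewrite (sum_labels lab xD) /f; last first.
    by rewrite !inE; case: lab => /negPf ->; rewrite andbF.
  rewrite big_distrr /=; apply: leq_sum => z zD; rewrite zD; lia.
apply: leq_sum => v /andP[vV bvx].
have lab' := labelling_merge lab xD vV bvx.
set F := acyc_fam _ _ _.
have le_F : #|[set p in F | m.+1 < #|anc b p x|]| <=
    #|[set p in F | m < #|anc (merge b x (b v)) p (b v)|]|.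
  apply: subset_leq_card; apply/subsetP => p; rewrite !in_sep.
  case/andP=> pF; rewrite pF /= => ltm.
  have px := acyc_fam_merge_val xD pF.
  have := subset_leq_card (@anc_merge b p x x xo _); rewrite px eqxx => /(_ bvx).
  move=> /(leq_trans ltm); rewrite cardsU1; case: (_ \notin _) => //.
  by rewrite add0n; apply: ltnW.
rewrite /f; case: ifPn => bvD.
  apply: leq_trans (leq_mul le_F (leqnn _)) _.
  rewrite expnS mulnCA.
  apply: leq_trans (leq_mul (leqnn _) (IH _ _ (upd q x v) _ lab' bvD)) _.
  rewrite weight_merge //; last by case/setD1P: bvD => _ /(labelling_neq_root lab).
  rewrite (cardsD1 x D) xD eq_esum_merge ?inE ?eqxx ?andbF //.
  by rewrite add1n expnS; lia.
(* Landing in the root class ends the path right after [x], so such a [v] contributes nothing. *)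
rewrite leqn0 muln_eq0; apply/orP; left; rewrite -leqn0.
apply: leq_trans le_F _; rewrite (labelling_root lab vV bvx bvD).
rewrite leqn0 cards_eq0; apply/eqP/setP => p; rewrite in_sep in_set0.
by rewrite anc_root cards0 andbF.
Qed.

(** The path of [x] is followed until it hits the root class; then [card_anc_ge] takes over for [y].
    One term for each step at which this may happen makes up the factor [m.+2]. *)
Lemma card_ancU_ge b D q x y m : labelling b D -> x \in D -> y \in D ->
  #|[set p in acyc_fam b D q | m.+1 < #|anc b p x :|: anc b p y|]| * #|Vs| ^ m.+1 <=
  m.+2 * (weight b o * #|Vs| ^ #|D|) * esum (weight b) m (D :\ x).
Proof.
elim: m b D q x y => [|m IH] b D q x y lab xD yD.
  apply: (@leq_trans (weight b o * #|Vs| ^ #|D|)); last by rewrite muln1 mul2n -addnn leq_addr.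
  rewrite expn1 -(card_acyc_fam q lab) mulnC leq_mul2l; apply/orP; right.
  by apply: subset_leq_card; apply/subsetP => p; rewrite in_sep => /andP[].
have xo := labelling_neq_root lab xD.
rewrite (card_acyc_fam_split q _ lab xD) big_distrl /=.
pose f z := if z \in D :\ x then
  m.+2 * (weight b o * #|Vs| ^ #|D|) * esum (weight b) m (D :\ x :\ z) else 0.
(* The share of a [v] in the root class: only the path of [y] is left, and the weight of the
   enlarged root class is bounded by [|Vs|]. *)
pose g := #|Vs| ^ #|D| * esum (weight b) m.+1 (D :\ x).
apply: (@leq_trans (\sum_(v in Vs | b v != x) ((b v == o) * g + f (b v)))); last first.
  rewrite big_split /= (sum_labels lab xD) /f; last first.
    by rewrite !inE; case: lab => /negPf ->; rewrite andbF.
  rewrite -big_distrl /= mulSn mulnDl /g; apply: leq_add.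
    rewrite mulnA !leq_mul2r; apply/orP; right; apply/orP; right.
    rewrite -big_mkcondr sum1_card; apply: subset_leq_card; apply/subsetP => v.
    by rewrite unfold_in /= !inE -andbA => /and3P[-> _ ->].
  rewrite big_distrr /=; apply: leq_sum => z zD; by rewrite zD mulnCA.
apply: leq_sum => v /andP[vV bvx].
have lab' := labelling_merge lab xD vV bvx.
(* For [y = x] both paths advance together to [b v]. *)
set F := acyc_fam _ _ _; set y' := if y == x then b v else y.
have le_F : #|[set p in F | m.+2 < #|anc b p x :|: anc b p y|]| <=
    #|[set p in F | m.+1 < #|anc (merge b x (b v)) p (b v) :|: anc (merge b x (b v)) p y'|]|.
  apply: subset_leq_card; apply/subsetP => p; rewrite !in_sep.
  case/andP=> pF; rewrite pF /= => ltm.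
  have px := acyc_fam_merge_val xD pF.
  have /subset_leq_card : anc b p x :|: anc b p y \subset
      x |: (anc (merge b x (b v)) p (b v) :|: anc (merge b x (b v)) p y').
    rewrite setUUr; apply: setUSS.
      by move: (@anc_merge b p x x xo); rewrite px eqxx; apply.
    by move: (@anc_merge b p x y xo); rewrite px; apply.
  move=> /(leq_trans ltm); rewrite cardsU1; case: (_ \notin _) => //.
  by rewrite add0n; apply: ltnW.
apply: leq_trans (leq_mul le_F (leqnn _)) _.
have DE : #|D| = #|D :\ x|.+1 by rewrite (cardsD1 x D) xD.
rewrite /f; case: ifPn => bvD.
  have [bvo|_] := eqVneq (b v) o; first by move: bvD; rewrite bvo !inE; case: lab => /negPf ->; rewrite andbF.
  rewrite mul0n add0n (expnS _ m.+1) mulnCA.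
  have y'D : y' \in D :\ x by rewrite /y'; case: eqP => // /eqP yx; rewrite !inE yx.
  apply: leq_trans (leq_mul (leqnn _) (IH _ _ (upd q x v) _ _ lab' bvD y'D)) _.
  rewrite weight_merge //; last by case/setD1P: bvD => _ /(labelling_neq_root lab).
  by rewrite DE eq_esum_merge ?inE ?eqxx ?andbF // expnS; lia.
have bvo := labelling_root lab vV bvx bvD; rewrite bvo eqxx mul1n addn0.
have ancE : (fun p => m.+1 < #|anc (merge b x o) p o :|: anc (merge b x o) p y'|) =1
    (fun p => m.+1 < #|anc (merge b x o) p y'|).
  by move=> p; rewrite anc_root set0U.
rewrite (_ : [set p in F | _] = [set p in F | m.+1 < #|anc (merge b x o) p y'|]); last first.
  by apply/setP => p; rewrite !in_sep ancE.
rewrite /y' bvo; case: ifPn => [_|yx].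
  rewrite [X in X * _ <= _](_ : _ = 0) //; apply/eqP; rewrite cards_eq0.
  by apply/eqP/setP => p; rewrite in_sep in_set0 anc_root cards0 andbF.
have yDx : y \in D :\ x by rewrite !inE yx.
rewrite /F bvo; rewrite bvo in lab'; apply: leq_trans (card_anc_ge _ _ lab' yDx) _.
rewrite /g DE expnS eq_esum_merge; first last.
- by rewrite -bvo; apply: (contra _ bvD) => /setD1P[].
- by rewrite !inE eqxx andbF.
apply: leq_mul; last by apply: leq_esum; apply: subsetDl.
by apply: leq_mul => //; apply: subset_leq_card; apply/subsetP => u; rewrite inE => /andP[].
Qed.

(** The Cayley formula and Maclaurin's inequality eliminate the weights, leaving only the number of
    labels. *)
Lemma card_ancU_ge_pr b D q x y m : labelling b D -> x \in D -> y \in D ->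
  #|[set p in acyc_fam b D q | m.+1 < #|anc b p x :|: anc b p y|]| * #|D| ^ m <=
  m.+2 * #|D| ^_ m * #|acyc_fam b D q|.
Proof.
move=> lab xD yD.
have wV z : weight b z <= #|Vs|.
  by apply: subset_leq_card; apply/subsetP => u; rewrite inE => /andP[].
have card0 : #|Vs| = 0 -> #|acyc_fam b D q| = 0.
  move=> n0; apply/eqP; rewrite cards_eq0; apply/eqP/setP => p; rewrite in_set0.
  by apply/negP => /acyc_famP[/(_ x xD)]; rewrite (cards0_eq n0) inE.
have [n0|npos] := posnP #|Vs|.
  rewrite (card0 n0) muln0 leqn0 muln_eq0 -leqn0 -{1}(card0 n0); apply/orP; left.
  by apply: subset_leq_card; apply/subsetP => p; rewrite in_sep => /andP[].
have sumw : \sum_(z in D) weight b z <= #|Vs|.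
  have -> : \sum_(z in D) weight b z = #|[set v in Vs | b v \in D]|.
    rewrite -sum1_card (partition_big b (mem D)) /=; last by move=> v; rewrite inE => /andP[].
    apply: eq_bigr => z zD; rewrite /weight -sum1_card; apply: eq_bigl => v; rewrite !inE.
    by case: (b v =P z) => [->|]; rewrite ?zD ?andbF ?andbT.
  by apply: subset_leq_card; apply/subsetP => u; rewrite inE => /andP[].
set H := #|_|; set N := #|acyc_fam b D q|.
have : H * #|Vs| ^ m.+1 <= m.+2 * (#|Vs| * N) * esum (weight b) m D.
  rewrite card_acyc_fam //; apply: leq_trans (card_ancU_ge _ _ lab xD yD) _.
  by rewrite leq_mul2l leq_esum ?orbT // subsetDl.
have : #|D| ^ m * esum (weight b) m D <= #|D| ^_ m * #|Vs| ^ m.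
  by apply: leq_trans (esum_maclaurin _ _ _) _; rewrite leq_mul2l; case: (m) => [|m'] //; rewrite leq_exp2r // sumw orbT.
rewrite expnS; set e := esum _ _ _; set k := #|D|; set n := #|Vs| => le_e le_H.
rewrite -(@leq_pmul2r (n ^ m.+1)) ?expn_gt0 ?npos // expnS.
have := leq_mul le_H (leqnn (k ^ m)).
have := leq_mul (leqnn (m.+2 * (n * N))) le_e; lia.
Qed.
End AcyclicFamilies.

(** * Graphs and connectivity *)

Section GraphBasics.
Variable T : finType.
Implicit Types (G H K B C : graph T) (x y u v w : T) (V W S : {set T}) (e : {set T}).

Lemma eq_set2 x y u v :
  ([set x; y] == [set u; v]) = (x == u) && (y == v) || (x == v) && (y == u).
Proof.
apply/eqP/orP => [E|[]/andP[/eqP-> /eqP->] //]; last by rewrite setUC.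
have: x \in [set u; v] by rewrite -E !inE eqxx.
have: y \in [set u; v] by rewrite -E !inE eqxx orbT.
have: u \in [set x; y] by rewrite E !inE eqxx.
have: v \in [set x; y] by rewrite E !inE eqxx orbT.
rewrite !inE => /orP[] /eqP -> /orP[] /eqP -> /orP[] /eqP ? /orP[] /eqP ?; subst;
  by rewrite !eqxx; auto.
Qed.

Lemma adj_sym G x y : adj G x y = adj G y x.
Proof. by rewrite /adj setUC. Qed.

Lemma eset_wf G e : e \in eset G -> #|e| = 2 /\ e \subset vset G.
Proof. by move=> eG; have /forall_inP/(_ e eG)/andP[/eqP] := graph_wf G. Qed.

Lemma adj_neq G x y : adj G x y -> x != y.
Proof. by move=> /eset_wf[]; rewrite cards2; case: (x != y). Qed.

Lemma adj_irr G x : adj G x x = false.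
Proof. by apply/negP => /adj_neq; rewrite eqxx. Qed.

Lemma adj_vset G x y : adj G x y -> (x \in vset G) && (y \in vset G).
Proof. by move=> /eset_wf[_]; rewrite subUset !sub1set. Qed.

Lemma adj_vsetl G x y : adj G x y -> x \in vset G.
Proof. by move/adj_vset/andP=> []. Qed.

Lemma adj_vsetr G x y : adj G x y -> y \in vset G.
Proof. by move/adj_vset/andP=> []. Qed.

Lemma esetP G e : reflect (exists x y, e = [set x; y] /\ adj G x y) (e \in eset G).
Proof.
apply: (iffP idP) => [eG|]; last by case=> x [y [->]].
have [/eqP/cards2P[x [y [_ Ee]]] _] := eset_wf eG.
by exists x, y; rewrite /adj -Ee.
Qed.

Lemma graph_eqP G H : vset G = vset H -> adj G =2 adj H -> G = H.
Proof.
move=> EV EA; apply: val_inj; rewrite /= [graph_data G]surjective_pairing.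
rewrite [graph_data H]surjective_pairing; congr pair => //; apply/setP => e.
by apply/esetP/esetP => -[x [y [-> a]]]; exists x, y; rewrite ?EA // -EA.
Qed.

Lemma adj_mkgraph V E x y :
  adj (mkgraph V E) x y = [&& x != y, x \in V, y \in V & [set x; y] \in E].
Proof.
rewrite /adj /eset /= inE cards2 subUset !sub1set.
by case: (x != y); rewrite ?andbF //= andbC -andbA.
Qed.

Definition induced G S : graph T := mkgraph S (eset G).

Lemma adj_induced G S x y :
  adj (induced G S) x y = [&& x \in S, y \in S & adj G x y].
Proof.
rewrite adj_mkgraph -/(adj G x y); case: (boolP (adj G x y)); rewrite ?andbF //.
by move=> /adj_neq ->.
Qed.

Lemma adj_del_vertex G z x y :
  adj (del_vertex G z) x y = [&& x != z, y != z & adj G x y].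
Proof.
rewrite adj_induced !inE; case: (boolP (adj G x y)); rewrite ?andbF //.
by move=> /adj_vset/andP[-> ->]; rewrite !andbT.
Qed.

Lemma adj_del_edge G e x y : adj (del_edge G e) x y = ([set x; y] != e) && adj G x y.
Proof.
rewrite adj_mkgraph !inE -/(adj G x y); case: (boolP (adj G x y)); rewrite ?andbF //.
by move=> a; rewrite (adj_neq a) (adj_vsetl a) (adj_vsetr a).
Qed.

Definition relgraph W (e : rel T) : graph T :=
  mkgraph W [set [set z.1; z.2] | z in [set z : T * T | e z.1 z.2]].

Lemma adj_relgraph W (e : rel T) x y :
  adj (relgraph W e) x y = [&& x != y, x \in W, y \in W & e x y || e y x].
Proof.
rewrite adj_mkgraph; case: (x != y) => //=; case: (x \in W) => //=.
case: (y \in W) => //=; apply/imsetP/orP => [[[u v]]|[] a].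
- rewrite inE /= => a /eqP; rewrite eq_set2.
  by case/orP => /andP[/eqP-> /eqP->]; [left|right].
- by exists (x, y); rewrite ?inE.
- by exists (y, x); rewrite ?inE // setUC.
Qed.

Lemma subgraphP H G :
  reflect (vset H \subset vset G /\ forall x y, adj H x y -> adj G x y) (subgraph H G).
Proof.
apply: (iffP andP) => -[sV sE]; split => //.
  by move=> x y; apply: (subsetP sE).
by apply/subsetP => e /esetP[x [y [-> /sE]]].
Qed.

Lemma subgraph_trans G H K : subgraph G H -> subgraph H K -> subgraph G K.
Proof.
move=> /subgraphP[sV sE] /subgraphP[sV' sE']; apply/subgraphP; split.
  exact: subset_trans sV'.
by move=> x y /sE/sE'.
Qed.

Lemma subgraph_vset H G : subgraph H G -> vset H \subset vset G.
Proof. by case/andP. Qed.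

Lemma subgraph_adj H G x y : subgraph H G -> adj H x y -> adj G x y.
Proof. by case/subgraphP => _; apply. Qed.

Lemma subgraph_anti G H : subgraph G H -> subgraph H G -> G = H.
Proof.
move=> /subgraphP[sV sE] /subgraphP[sV' sE']; apply: graph_eqP.
  by apply/eqP; rewrite eqEsubset sV.
by move=> x y; apply/idP/idP; auto.
Qed.

Lemma subgraph_induced G S : S \subset vset G -> subgraph (induced G S) G.
Proof. by move=> SG; apply/subgraphP; split => // x y; rewrite adj_induced => /and3P[]. Qed.

Lemma sub_induced H G S : subgraph H G -> vset H \subset S -> subgraph H (induced G S).
Proof.
move=> /subgraphP[_ sE] sS; apply/subgraphP; split => // x y a.
by rewrite adj_induced sE // !(subsetP sS) // ?(adj_vsetl a) ?(adj_vsetr a).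
Qed.

Lemma maximal_subgraphP (P : pred (graph T)) G H :
  reflect [/\ subgraph H G, P H &
      forall K, subgraph K G -> P K -> subgraph H K -> K = H]
    (maximal_subgraph P G H).
Proof.
apply: (iffP and3P) => -[sHG PH maxH]; split=> //.
  by move=> K sKG PK sHK; apply/eqP/(implyP (forallP maxH K)); rewrite sKG PK.
by apply/forallP => K; apply/implyP => /and3P[? ? ?]; apply/eqP/maxH.
Qed.

Lemma connect_adj_sym G : connect_sym (adj G).
Proof. by apply: sym_connect_sym => x y; apply: adj_sym. Qed.

Lemma connect_vset G x y : connect (adj G) x y -> x \in vset G -> y \in vset G.
Proof.
move=> /connectP[p]; elim: p x => [|z p IH] x /= => [_ -> //|/andP[a pth] yE _].
exact: IH pth yE (adj_vsetr a).
Qed.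

Lemma connect_mono G H x y : (forall x y, adj G x y -> adj H x y) ->
  connect (adj G) x y -> connect (adj H) x y.
Proof. by move=> sub; apply: connect_sub => u v a; apply/connect1/sub. Qed.

Lemma connect_subgraph G H x y : subgraph G H ->
  connect (adj G) x y -> connect (adj H) x y.
Proof. by move=> /subgraphP[_ sub]; apply: connect_mono. Qed.

Lemma connected_graphP G : reflect
  (vset G != set0 /\ {in vset G &, forall x y, connect (adj G) x y})
  (connected_graph G).
Proof.
apply: (iffP andP) => -[n0 con]; split => //.
  by move=> x y xG yG; apply/(forall_inP (forall_inP con x xG)).
by apply/forall_inP => x xG; apply/forall_inP => y yG; apply: con.
Qed.

Lemma connected_graph_root G r : r \in vset G ->
  {in vset G, forall x, connect (adj G) x r} -> connected_graph G.
Proof.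
move=> rG con; apply/connected_graphP; split; first by apply/set0Pn; exists r.
move=> x y xG yG; apply: connect_trans (con x xG) _.
by rewrite connect_adj_sym con.
Qed.

Lemma connect_stable G (P : pred T) x y :
  (forall u v, adj G u v -> P u -> P v) -> connect (adj G) x y -> P x -> P y.
Proof.
move=> cl /connectP[p]; elim: p x => [|z p IH] x /= => [_ -> //|/andP[a pth] yE Px].
exact: IH pth yE (cl _ _ a Px).
Qed.

(* Unlike [two_connected], this includes one vertex and one edge, so that the
   blocks are the maximal subgraphs of this kind. *)
Definition nonseparable G : bool :=
  connected_graph G &&
  [forall x in vset G, (vset G == [set x]) || connected_graph (del_vertex G x)].

Lemma nonseparableP G : reflect
  (connected_graph G /\ {in vset G, forall x, vset G != [set x] -> connected_graph (del_vertex G x)})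
  (nonseparable G).
Proof.
apply: (iffP andP) => -[con del]; split => //.
  by move=> x xG /negPf n; have := forall_inP del x xG; rewrite n.
by apply/forall_inP => x xG; case: eqVneq => //= /(del x xG).
Qed.

Lemma nonseparable_connect G z x y : nonseparable G ->
  x \in vset G -> y \in vset G -> x != z -> y != z ->
  connect (adj (del_vertex G z)) x y.
Proof.
move=> /nonseparableP[/connected_graphP[_ con] del] xG yG xz yz.
have [zG|zG] := boolP (z \in vset G).
  have /connected_graphP[_] : connected_graph (del_vertex G z).
    by apply: del => //; apply: contraNneq xz => E; move: xG; rewrite E inE.
  by apply; rewrite !inE ?xz ?yz.
apply: connect_mono (con x y xG yG) => u v a; rewrite adj_del_vertex a andbT.
by apply/andP; split; apply: contraNneq zG => <-; rewrite ?(adj_vsetl a) ?(adj_vsetr a).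
Qed.

Lemma two_connectedE G : two_connected G = (3 <= #|vset G|) && nonseparable G.
Proof.
rewrite /two_connected /nonseparable; case: leqP => //= c3; congr (_ && _).
apply: eq_forallb => x; congr (_ ==> _); case: eqVneq => // E.
by rewrite E cards1 in c3.
Qed.

Lemma connected_neighbour G x y : connected_graph G -> x \in vset G -> y \in vset G ->
  x != y -> exists z, adj G x z.
Proof.
move=> /connected_graphP[_ con] xG yG; have /connectP[[|z p] /=] := con x y xG yG.
  by move=> _ ->; rewrite eqxx.
by case/andP=> a _ _ _; exists z.
Qed.
End GraphBasics.

(** * Components and blocks *)

Section Components.
Variable T : finType.
Implicit Types (G H K B C : graph T) (x y u v w : T) (V W S : {set T}) (e : {set T}).

Definition compset G x : {set T} := [set y | connect (adj G) x y].

Definition comp_of G x : graph T := induced G (compset G x).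

Lemma compset_sub G x : x \in vset G -> compset G x \subset vset G.
Proof. by move=> xG; apply/subsetP => y; rewrite inE => /connect_vset; apply. Qed.

Lemma compset_id G x : x \in compset G x.
Proof. by rewrite inE connect0. Qed.

Lemma comp_of_sub G x : x \in vset G -> subgraph (comp_of G x) G.
Proof. by move=> xG; apply/subgraph_induced/compset_sub. Qed.

Lemma eq_compset G x y : connect (adj G) x y -> compset G x = compset G y.
Proof.
by move=> xy; apply/setP => z; rewrite !inE (same_connect (@connect_adj_sym _ G) xy).
Qed.

Lemma comp_of_connect G x y : connect (adj G) x y -> connect (adj (comp_of G x)) x y.
Proof.
move=> xy; refine (@connect_stable _ G (connect (adj (comp_of G x)) x) x y _ xy (connect0 _ _)).
move=> u v a xu.
apply: connect_trans (xu) _; apply: connect1; rewrite adj_induced a andbT !inE.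
have xu' : connect (adj G) x u.
  by apply: connect_mono xu => ? ?; rewrite adj_induced => /and3P[].
by rewrite xu' (connect_trans xu') // connect1.
Qed.

Lemma comp_of_connected G x : connected_graph (comp_of G x).
Proof.
apply: (@connected_graph_root _ _ x); first exact: compset_id.
by move=> y; rewrite inE => /comp_of_connect; rewrite connect_adj_sym.
Qed.

Lemma connected_sub_comp G K x : connected_graph K -> subgraph K G -> x \in vset K ->
  subgraph K (comp_of G x).
Proof.
move=> /connected_graphP[_ con] sKG xK; apply: sub_induced => //.
by apply/subsetP => y yK; rewrite inE (connect_subgraph sKG) ?con.
Qed.

Lemma componentsE G : components G = [set comp_of G x | x in vset G].
Proof.
apply/setP => C; rewrite inE; apply/maximal_subgraphP/imsetP => [[sCG con maxC]|[x xG ->]].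
  have /connected_graphP[/set0Pn[x xC] _] := con.
  have xG : x \in vset G by apply: subsetP xC; apply: subgraph_vset.
  exists x => //; symmetry; apply: maxC; rewrite ?comp_of_connected ?comp_of_sub //.
  exact: connected_sub_comp.
split; rewrite ?comp_of_connected ?comp_of_sub // => K sKG conK sxK.
have xK : x \in vset K by apply: (subsetP (subgraph_vset sxK)); apply: compset_id.
by apply: subgraph_anti => //; apply: connected_sub_comp.
Qed.

Lemma component_sub G C : C \in components G -> subgraph C G.
Proof. by rewrite inE => /maximal_subgraphP[]. Qed.

Lemma component_is_connected G C : C \in components G -> connected_graph C.
Proof. by rewrite inE => /maximal_subgraphP[]. Qed.

Lemma component_comp_of G C x : C \in components G -> x \in vset C -> C = comp_of G x.
Proof.
rewrite componentsE => /imsetP[y yG ->]; rewrite inE => yx.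
by rewrite /comp_of (eq_compset yx).
Qed.

Lemma component_closed G C x y : C \in components G -> x \in vset C -> adj G x y -> adj C x y.
Proof.
move=> CG xC a; rewrite (component_comp_of CG xC) adj_induced a !inE connect0.
by rewrite connect1.
Qed.

Lemma component_vset_inj G : {in components G &, injective (@vset T)}.
Proof.
move=> C D CG DG E; have /connected_graphP[/set0Pn[x xC] _] := component_is_connected CG.
have xD : x \in vset D by rewrite -E.
by rewrite (component_comp_of CG xC) (component_comp_of DG xD).
Qed.

Lemma card_components G : #|components G| = #|[set compset G x | x in vset G]|.
Proof.
rewrite -(card_in_imset (@component_vset_inj G)) componentsE; congr #|pred_of_set _|.
by rewrite -imset_comp.
Qed.

(** Taking unions maps the components of [G - e] onto those of [G]. If deleting the edge separates
    [u] from [v], their two components get the same image, so the number has grown; otherwise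
    nothing changes. *)
Lemma bridgeE G u v : adj G u v ->
  bridge G [set u; v] = ~~ connect (adj (del_edge G [set u; v])) u v.
Proof.
move=> a; set e := [set u; v]; set G' := del_edge G e.
rewrite /bridge (_ : e \in eset G = true) //= !card_components.
have subG' x y : connect (adj G') x y -> connect (adj G) x y.
  by apply: connect_mono => ? ?; rewrite adj_del_edge => /andP[].
have [uv|uv] := boolP (connect _ u v).
  rewrite (_ : [set compset G' x | x in _] = [set compset G x | x in vset G]) ?ltnn //.
  apply: eq_imset => x; apply/setP => y; rewrite !inE.
  apply/idP/idP; first exact: subG'.
  apply: connect_sub => z w zw; have [|ne] := eqVneq [set z; w] e; last first.
    by apply: connect1; rewrite adj_del_edge ne.
  move/eqP; rewrite eq_set2 => /orP[] /andP[/eqP-> /eqP->] //.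
  by rewrite connect_adj_sym.
pose h S := \bigcup_(x in S) compset G x.
have hE x : h (compset G' x) = compset G x.
  apply/setP => y; apply/bigcupP/idP => [[z]|xy]; last by exists x; rewrite ?compset_id.
  by rewrite inE => /subG' /eq_compset ->.
have -> : [set compset G x | x in vset G] = h @: [set compset G' x | x in vset G'].
  by rewrite -imset_comp; apply: eq_imset => x /=; rewrite hE.
rewrite ltn_neqAle leq_imset_card andbT; apply/negP => /imset_injP inj.
have uG' : u \in vset G' by rewrite (adj_vsetl a).
have vG' : v \in vset G' by rewrite (adj_vsetr a).
have /inj : h (compset G' u) = h (compset G' v) by rewrite !hE; apply/eq_compset/connect1.
rewrite !imset_f // => /(_ isT isT) E; have := compset_id G' v.
by rewrite -E inE (negPf uv).
Qed.
End Components.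

(** * Blocks as maximal nonseparable subgraphs *)

Section Blocks.
Variable T : finType.
Implicit Types (G H K B C : graph T) (x y u v w : T) (V W S : {set T}) (e : {set T}).

Lemma path_connect_del G S x y (s : seq T) : path (adj G) y s ->
  {subset y :: s <= S} -> x \notin y :: s ->
  connect (adj (del_vertex (induced G S) x)) y (last y s).
Proof.
elim: s y => [|z s IH] y /=; first by rewrite connect0.
case/andP=> a pth sub; rewrite in_cons negb_or => /andP[xy xzs].
apply: connect_trans (IH z pth _ xzs); last by move=> w ws; apply: sub; rewrite in_cons ws orbT.
apply: connect1; rewrite adj_del_vertex adj_induced a andbT ![_ == x]eq_sym xy.
by move: xzs; rewrite in_cons negb_or => /andP[-> _] /=; rewrite !sub ?inE ?eqxx ?orbT.
Qed.

(** A path from [u] to [v] avoiding the edge closes up to a cycle. After deletion of one vertex,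
    every other vertex still follows an arc to [u] or to [v]. *)
Lemma cycle_nonseparable G u v : adj G u v ->
  connect (adj (del_edge G [set u; v])) u v ->
  exists K, [/\ nonseparable K, subgraph K G, adj K u v & 2 < #|vset K|].
Proof.
move=> a /connectP[p0 pth0]; case/shortenP: pth0 => p pth' up _ vE.
have pth : path (adj G) u p.
  by apply: sub_path pth' => x y; rewrite adj_del_edge => /andP[].
pose S := [set z in u :: p]; exists (induced G S).
have subS : {subset u :: p <= S} by move=> z; rewrite in_set.
have uS : u \in S by rewrite in_set mem_head.
have vS : v \in S by rewrite in_set vE mem_last.
have auv : adj (induced G S) u v by rewrite adj_induced uS vS.
have reach x z : z \in S -> z != x ->
    connect (adj (del_vertex (induced G S) x)) z u || connect (adj (del_vertex (induced G S) x)) z v.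
  rewrite in_set => zup zx.
  case/splitPl: zup pth up vE subS => p1 p2 zE.
  rewrite cat_path last_cat zE -cat_cons => /andP[pth1 pth2].
  rewrite cat_uniq => /and3P[_ disj _] -> sub.
  have [xp1|xp1] := boolP (x \in u :: p1).
    apply/orP; right; apply: path_connect_del => //.
      move=> w; rewrite in_cons => /predU1P[->|wp2]; apply: sub; rewrite mem_cat.
        by rewrite -zE mem_last.
      by rewrite wp2 orbT.
    rewrite in_cons negb_or eq_sym zx /=; apply: contraNN disj => xp2.
    by apply/hasP; exists x.
  apply/orP; left; rewrite connect_adj_sym -zE; apply: path_connect_del => //.
  by move=> w wp1; apply: sub; rewrite mem_cat wp1.
split=> //.
- apply/nonseparableP; split.
    apply: (@connected_graph_root _ _ u) => // z zS; have [->|zu] := eqVneq z u; first exact: connect0.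
    have del x y w : connect (adj (del_vertex (induced G S) x)) y w -> connect (adj (induced G S)) y w.
      by apply: connect_mono => ? ?; rewrite adj_del_vertex => /and3P[].
    have [->|zv] := eqVneq z v; first by rewrite connect1 // adj_sym.
    have /orP[/del//|/del zv'] := reach u z zS zu.
    by apply: connect_trans zv' _; rewrite connect1 // adj_sym.
  move=> x _ _; have delP y z : y != x -> connect (adj (del_vertex (induced G S) x)) y z -> z != x.
    move=> yx yz; apply: (@connect_stable _ _ (fun w => w != x) _ _ _ yz yx) => w w'.
    by rewrite adj_del_vertex => /and3P[].
  have [ux|ux] := eqVneq u x.
    have vx : v != x by rewrite -ux eq_sym (adj_neq a).
    apply: (@connected_graph_root _ _ v); first by rewrite in_setD1 vx.
    move=> z /setD1P[zx zS]; have /orP[/(delP _ _ zx)|//] := reach x z zS zx.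
    by rewrite ux eqxx.
  apply: (@connected_graph_root _ _ u); first by rewrite in_setD1 ux.
  move=> z /setD1P[zx zS]; have /orP[//|zv] := reach x z zS zx.
  have vx := delP _ _ zx zv; apply: connect_trans zv _; apply: connect1.
  by rewrite adj_del_vertex adj_sym auv ux vx.
- apply: subgraph_induced; apply/subsetP => z; rewrite in_set => zp.
  case/splitPl: zp pth {up vE pth' subS uS vS auv reach S} => p1 p2 <-.
  rewrite cat_path => /andP[pth1 _].
  by apply: connect_vset (adj_vsetl a); apply/connectP; exists p1.
(* A path with a single edge would be the deleted edge itself, so there is a third vertex. *)
- have [w wS /andP[wu wv]] : exists2 w, w \in S & (w != u) && (w != v).
    case: p pth' up vE {pth subS vS auv reach} @S uS => [|w [|w' p]] /=.
    + by move=> _ _ E; rewrite E adj_irr in a.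
    + by move=> + _ vE; rewrite andbT adj_del_edge vE eqxx.
    + move=> _ /and3P[uw ww' _] vE _; exists w; first by rewrite !inE eqxx orbT.
      rewrite eq_sym; move: uw; rewrite !inE negb_or => /andP[-> _] /=.
      by apply: contraNneq ww' => ->; rewrite vE mem_last.
  apply: (@leq_trans #|[set w; u; v]|).
    by rewrite -setUA cardsU1 cards2 !inE negb_or wu wv (adj_neq a).
  by apply: subset_leq_card; apply/subsetP => z; rewrite !in_setU !in_set1 -orbA => /or3P[] /eqP ->.
Qed.

Lemma nonseparable1 x : nonseparable (mkgraph [set x] set0 : graph T).
Proof.
apply/nonseparableP; split.
  by apply: (@connected_graph_root _ _ x) => [|y]; rewrite inE // => /eqP ->; apply: connect0.
by move=> y; rewrite inE => /eqP ->; rewrite eqxx.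
Qed.

Lemma nonseparable2 u v : u != v -> nonseparable (mkgraph [set u; v] [set [set u; v]]).
Proof.
move=> uv; set B := mkgraph _ _.
have a : adj B u v by rewrite adj_mkgraph uv !inE !eqxx orbT.
apply/nonseparableP; split.
  apply: (@connected_graph_root _ _ u) => [|y]; rewrite !inE ?eqxx //.
  by case/orP => /eqP ->; [apply: connect0|apply: connect1; rewrite adj_sym].
move=> y yB _; have [z [zB zy zE]] : exists z, [/\ z \in vset B, z != y & forall w, w \in vset B -> w != y -> w = z].
  move: yB; rewrite !inE => /orP[] /eqP ->; [exists v|exists u]; split; rewrite ?inE ?eqxx ?orbT // 1?eq_sym //;
  by move=> w; rewrite !inE => /orP[] /eqP ->; rewrite ?eqxx.
apply: (@connected_graph_root _ _ z); first by rewrite in_setD1 zy.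
by move=> w /setD1P[wy wB]; rewrite (zE w wB wy) connect0.
Qed.

(** The three kinds of blocks are told apart by size: with two vertices, maximality means that the
    edge lies on no cycle, hence is a bridge; with one vertex, that the vertex is isolated. *)
Lemma blocksE G B : (B \in blocks G) = maximal_subgraph (@nonseparable T) G B.
Proof.
rewrite inE; apply/or3P/maximal_subgraphP => [[]|[sBG nsB maxB]].
- case/maximal_subgraphP; rewrite two_connectedE => sBG /andP[B3 nsB] maxB.
  split=> // K sKG nsK sBK; apply: maxB => //; rewrite two_connectedE nsK andbT.
  exact: leq_trans B3 (subset_leq_card (subgraph_vset sBK)).
- case/existsP => e /andP[be /eqP ->].
  have /esetP[u [v [Ee a]]] : e \in eset G by case/andP: be.
  move: be; rewrite {e}Ee bridgeE // => nuv.
  have aB : adj (mkgraph [set u; v] [set [set u; v]]) u v.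
    by rewrite adj_mkgraph (adj_neq a) !inE !eqxx orbT.
  split; [|exact: nonseparable2 (adj_neq a)|].
    apply/subgraphP; split => [|x y]; first by rewrite subUset !sub1set (adj_vsetl a) (adj_vsetr a).
    rewrite adj_mkgraph in_set1 eq_set2 => /and4P[_ _ _ /orP[]] /andP[/eqP-> /eqP->] //.
    by rewrite adj_sym.
  move=> K sKG nsK sBK; apply: subgraph_anti => //.
  have [uK vK] : u \in vset K /\ v \in vset K.
    by split; apply: (subsetP (subgraph_vset sBK)); rewrite !inE eqxx ?orbT.
  suff sub : vset K \subset [set u; v].
    apply/subgraphP; split => // x y axy; rewrite adj_mkgraph (adj_neq axy).
    move: (subsetP sub _ (adj_vsetl axy)) (subsetP sub _ (adj_vsetr axy)) (adj_neq axy).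
    rewrite !inE eq_set2 => /orP[] /eqP -> /orP[] /eqP ->; by rewrite ?eqxx ?orbT.
  apply/subsetP => w wK; apply: contraNT nuv; rewrite !inE negb_or => /andP[wu wv].
  have del z x y : z \in [set u; v] -> connect (adj (del_vertex K z)) x y ->
      connect (adj (del_edge G [set u; v])) x y.
    move=> zuv; apply: connect_mono => s t; rewrite adj_del_vertex adj_del_edge => /and3P[sz tz].
    move=> /(subgraph_adj sKG) ->; rewrite andbT; apply: contraTneq zuv => <-.
    by rewrite !inE negb_or ![z == _]eq_sym sz.
  have uv := adj_neq a.
  apply: (@connect_trans _ _ w).
    apply: (del v); first by rewrite !inE eqxx orbT.
    by apply: nonseparable_connect.
  apply: (del u); first by rewrite !inE eqxx.
  by apply: nonseparable_connect => //; rewrite eq_sym.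
- case/existsP => x /andP[/andP[xG /forallP iso] /eqP ->].
  split; [|exact: nonseparable1|].
    apply/subgraphP; split => [|y z]; first by rewrite sub1set.
    by rewrite adj_mkgraph in_set0 !andbF.
  move=> K sKG /nonseparableP[conK _] sBK.
  have xK : x \in vset K by apply: (subsetP (subgraph_vset sBK)); rewrite inE.
  have KE y : y \in vset K -> y = x.
    move=> yK; apply/eqP; rewrite eq_sym; apply: contraTT isT => xy.
    have [z a] := connected_neighbour conK xK yK xy.
    by have := iso z; rewrite (subgraph_adj sKG a).
  apply: graph_eqP => [|y z].
    by apply/setP => y; rewrite inE; apply/idP/eqP => [/KE//|->].
  rewrite adj_mkgraph in_set0 !andbF; apply/negP => a.
  by move: (adj_neq a); rewrite (KE y (adj_vsetl a)) (KE z (adj_vsetr a)) eqxx.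
have [conB _] := nonseparableP _ nsB; have /connected_graphP[Bn0 _] := conB.
case: (ltngtP #|vset B| 2) => B2.
- constructor 3.
  have /cards1P[x VB] : #|vset B| == 1 by rewrite eqn_leq -ltnS B2 card_gt0.
  have xB : x \in vset B by rewrite VB inE.
  have BE : B = mkgraph [set x] set0.
    apply: graph_eqP => // y z; rewrite adj_mkgraph in_set0 !andbF; apply/negP => a.
    move: (adj_vsetl a) (adj_vsetr a) (adj_neq a); rewrite VB !inE.
    by move=> /eqP-> /eqP->; rewrite eqxx.
  apply/existsP; exists x; rewrite BE eqxx andbT /isolated (subsetP (subgraph_vset sBG)) //=.
  apply/forallP => y; apply/negP => a.
  have sKG : subgraph (mkgraph [set x; y] [set [set x; y]]) G.
    apply/subgraphP; split => [|s t]; first by rewrite subUset !sub1set (adj_vsetl a) (adj_vsetr a).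
    rewrite adj_mkgraph in_set1 eq_set2 => /and4P[_ _ _ /orP[]] /andP[/eqP-> /eqP->] //.
    by rewrite adj_sym.
  have : y \in vset B.
    rewrite -(maxB _ sKG (nonseparable2 (adj_neq a))) ?inE ?eqxx ?orbT //.
    apply/subgraphP; split; first by rewrite VB sub1set !inE eqxx.
    by move=> s t; rewrite {1}BE adj_mkgraph in_set0 !andbF.
  by rewrite VB inE => /eqP yx; rewrite yx adj_irr in a.
- constructor 1; apply/maximal_subgraphP; rewrite two_connectedE B2; split => // K sKG.
  by rewrite two_connectedE => /andP[_ nsK]; apply: maxB.
- constructor 2.
  have /cards2P[u [v [uv VB]]] : #|vset B| == 2 by rewrite B2.
  have [uB vB] : u \in vset B /\ v \in vset B by rewrite VB !inE !eqxx orbT.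
  have a : adj B u v.
    have [z a] := connected_neighbour conB uB vB uv.
    move: (adj_vsetr a) (adj_neq a); rewrite VB !inE => /orP[] /eqP zE; rewrite zE ?eqxx // in a *.
  have aG := subgraph_adj sBG a.
  apply/existsP; exists [set u; v]; rewrite bridgeE //; apply/andP; split.
    apply/negP => /(cycle_nonseparable aG)[K [nsK sKG aK K3]].
    have KB : K = B.
      apply: maxB => //; apply/subgraphP; split.
        by rewrite VB subUset !sub1set (adj_vsetl aK) (adj_vsetr aK).
      move=> s t st; move: (adj_vsetl st) (adj_vsetr st) (adj_neq st); rewrite VB !inE.
      by move=> /orP[] /eqP -> /orP[] /eqP ->; rewrite ?eqxx // adj_sym.
    by rewrite KB B2 in K3.
  apply/eqP; apply: graph_eqP => // s t; rewrite adj_mkgraph in_set1 -VB.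
  apply/idP/and4P => [st|[_ _ _]].
    rewrite (adj_vsetl st) (adj_vsetr st) (adj_neq st); split => //.
    move: (adj_vsetl st) (adj_vsetr st) (adj_neq st); rewrite VB !inE eq_set2.
    by move=> /orP[] /eqP -> /orP[] /eqP ->; rewrite !eqxx ?orbT.
  by rewrite VB eq_set2 => /orP[] /andP[/eqP-> /eqP->] //; rewrite adj_sym.
Qed.
End Blocks.

(** * Hanging blocks on a tree of pointers *)

Section AcyclicFunctions.
Variables (T : finType) (f : T -> T) (r : T).
Hypothesis fr : f r = r.
Implicit Types (x y v : T).

Lemma fconnect_root x : fconnect f r x -> x = r.
Proof.
move=> /iter_findex; elim: (findex _ _ _) => [//|m IH].
by rewrite iterSr fr.
Qed.

(** After [m] rounds a vertex on a cycle is back at itself, yet by then its orbit has reached the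
    fixed point [r]. *)
Lemma fconnect_no_cycle v : fconnect f v r -> fconnect f (f v) v -> v = r.
Proof.
move=> /iter_findex vr /iter_findex; rewrite -iterSr; move: (findex _ _ _) vr (findex _ _ _) => m vr k vv.
have cyc j : iter (j * k.+1) f v = v by elim: j => // j IH; rewrite mulSn iterD IH vv.
have fix_r j : iter j f r = r by elim: j => //= j ->.
by rewrite -[LHS](cyc m) mulnS addnC iterD vr fix_r.
Qed.

Lemma fconnect_cases x y : fconnect f x y -> x = y \/ fconnect f (f x) y.
Proof.
move=> /iter_findex; case: (findex _ _ _) => [|m]; first by left.
by rewrite iterSr => <-; right; rewrite fconnect_iter.
Qed.

Lemma order_fconnect x y : fconnect f x y -> order f y <= order f x.
Proof. by move=> xy; apply: subset_leq_card; apply/subsetP => z; apply: connect_trans. Qed.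

(** [order] is the size of the orbit, that is the distance to [r] plus one; it serves as depth in
    all later inductions. *)
Lemma order_next v : fconnect f v r -> v != r -> order f v = (order f (f v)).+1.
Proof.
move=> vr vnr; rewrite /order (cardD1 v) inE connect0 add1n; congr _.+1.
apply: eq_card => z; rewrite !inE; apply/andP/idP => [[zv /fconnect_cases[E|//]]|vz].
  by rewrite E eqxx in zv.
split; last exact: connect_trans (fconnect1 _ _) vz.
by apply: contraNneq vnr => zv; apply/eqP/fconnect_no_cycle; rewrite // -{2}zv.
Qed.

Lemma order_root_lt v : fconnect f v r -> v != r -> order f r < order f v.
Proof.
move=> vr vnr; have [E|] := fconnect_cases vr; first by rewrite E eqxx in vnr.
by move=> /order_fconnect; rewrite (order_next vr vnr) ltnS.
Qed.

Lemma order_fconnect_eq x y : fconnect f x r -> fconnect f x y ->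
  order f x <= order f y -> x = y.
Proof.
move=> xr xy le; have [->//|xy'] := fconnect_cases xy.
have [xE|xnr] := eqVneq x r; first by rewrite xE in xy *; rewrite (fconnect_root xy).
by move: le; rewrite (order_next xr xnr) ltnNge order_fconnect.
Qed.
End AcyclicFunctions.

(** * Blocks of a graph with hung bodies *)

Section Hanging.
Variable T : finType.
Implicit Types (G H K B C : graph T) (x y u v w : T) (V W S : {set T}).

(* Every block of [H] contains [r]. *)
Definition flat H (r : T) : Prop :=
  [/\ r \in vset H, connected_graph H &
      {in vset H, forall x, x != r -> connected_graph (del_vertex H x)}].

(** The function lives on vertices and is constant along edges avoiding [r], hence on each body; no
    type of bodies is needed. *)
Definition pointer H (r : T) (par : T -> T) : Prop :=
  [/\ par r = r, {in vset H, forall v, par v \in vset H},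
      forall u v, adj H u v -> u != r -> v != r -> par u = par v &
      {in vset H, forall v, fconnect par v r}].

(* The edges from [r] to a component of [H - r] are moved to the vertex to which
   [par] sends that component. *)
Definition hang H (r : T) (par : T -> T) : graph T :=
  relgraph (vset H) (fun u v =>
    [&& adj H u v, u != r & v != r] || (adj H r v && (u == par v))).

Definition body_label H (r : T) (v : T) : T := root (adj (del_vertex H r)) v.

Definition body H (r : T) (v : T) : {set T} :=
  [set u in vset H | (u != r) && (body_label H r u == body_label H r v)].

Definition hung_block H (r : T) par (v : T) : graph T :=
  induced (hang H r par) (par v |: body H r v).

Section Pointers.
Variables (H : graph T) (r : T) (par : T -> T).
Hypotheses (flatH : flat H r) (parH : pointer H r par).
Local Notation V := (vset H).
Local Notation lab := (body_label H r).
Local Notation K := (hang H r par).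
Local Notation blk := (hung_block H r par).

Let par_r : par r = r. Proof. by case: parH. Qed.
Let par_V v : v \in V -> par v \in V. Proof. by case: parH => _ + _ _; apply. Qed.
Let par_adj u v : adj H u v -> u != r -> v != r -> par u = par v.
Proof. by case: parH => _ _ + _; apply. Qed.
Let par_fconnect v : v \in V -> fconnect par v r.
Proof. by case: parH => _ _ _; apply. Qed.
Let rV : r \in V. Proof. by case: flatH. Qed.

Lemma reach_vset u w : u \in V -> fconnect par u w -> w \in V.
Proof.
by move=> uV /iter_findex <-; elim: (findex _ _ _) => [|m IH] //=; apply: par_V.
Qed.

Lemma body_label_connect u v : (lab u == lab v) = connect (adj (del_vertex H r)) u v.
Proof. exact/root_connect/connect_adj_sym. Qed.

Lemma body_label_eq u v : connect (adj (del_vertex H r)) u v -> lab u = lab v.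
Proof. by rewrite -body_label_connect => /eqP. Qed.

Lemma body_label_id v : connect (adj (del_vertex H r)) v (lab v).
Proof. exact: connect_root. Qed.

Lemma body_label_idem v : lab (lab v) = lab v.
Proof. by apply/esym/body_label_eq/body_label_id. Qed.

Lemma connect_del_root u v : u != r -> connect (adj (del_vertex H r)) u v -> v != r.
Proof.
move=> ur uv; apply: (@connect_stable _ _ (fun w => w != r) _ _ _ uv ur) => w w'.
by rewrite adj_del_vertex => /and3P[].
Qed.

Lemma body_label_neq v : v != r -> lab v != r.
Proof. by move=> vr; apply: connect_del_root (body_label_id v). Qed.

Lemma body_label_vset v : v \in V -> lab v \in V.
Proof.
move=> vV; apply: connect_vset vV; apply: connect_mono (body_label_id v) => u w.
by rewrite adj_del_vertex => /and3P[].
Qed.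

Lemma body_label_root : lab r = r.
Proof.
apply/eqP; apply: contraT => nr; have := body_label_id r.
by rewrite connect_adj_sym => /(connect_del_root nr); rewrite eqxx.
Qed.

Lemma adj_body_label u v : adj H u v -> u != r -> v != r -> lab u = lab v.
Proof. by move=> a ur vr; apply/body_label_eq/connect1; rewrite adj_del_vertex ur vr. Qed.

Lemma par_body_label u v : lab u = lab v -> par u = par v.
Proof.
move=> /eqP; rewrite body_label_connect => uv.
apply/eqP; refine (@connect_stable _ _ (fun w => par u == par w) u v _ uv (eqxx _)).
by move=> x y; rewrite adj_del_vertex => /and3P[xr yr a] /eqP ->; rewrite (par_adj a).
Qed.

Lemma par_lab v : par (lab v) = par v.
Proof. exact/par_body_label/body_label_idem. Qed.

(** Otherwise [par] agrees at [v] and [par v], so [par v] is a fixed point, that is [r], which lies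
    in no body. *)
Lemma body_label_par v : v \in V -> v != r -> lab (par v) != lab v.
Proof.
move=> vV vr; apply/eqP => E; have pp := par_body_label E.
have pr : par v = r.
  by apply: fconnect_no_cycle (par_fconnect (par_V vV)) _; rewrite // pp connect0.
by have := body_label_neq vr; rewrite -E pr body_label_root eqxx.
Qed.

Lemma par_par v : v \in V -> v != r -> par (par v) != v.
Proof.
move=> vV vr; apply: contraNneq vr => E; apply/eqP.
by apply: fconnect_no_cycle (par_fconnect vV) _; rewrite // -{2}E fconnect1.
Qed.

Lemma par_neq v : v \in V -> v != r -> par v != v.
Proof. by move=> vV vr; apply: contraNneq (body_label_par vV vr) => ->. Qed.

Lemma vset_hang : vset K = V. Proof. by []. Qed.

Lemma adj_hang u v : adj K u v =
  [&& u != v, u \in V, v \in V &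
   [|| [&& adj H u v, u != r & v != r], adj H r v && (u == par v) |
       adj H r u && (v == par u)]].
Proof.
rewrite adj_relgraph; congr [&& _, _, _ & _].
rewrite [adj H v u]adj_sym; case: (adj H u v); case: (u != r); case: (v != r);
by rewrite ?orbT ?orbF.
Qed.

(** Other sources of such an edge are excluded: [par v] is outside the body of [v], and pointers
    have no cycle of length two. *)
Lemma adj_hang_par v : v \in V -> v != r -> adj K (par v) v = adj H r v.
Proof.
move=> vV vr; rewrite adj_hang par_neq // par_V // vV eqxx andbT /=.
case: (boolP (adj H r v)) => _ /=; first by rewrite orbT.
rewrite [v == par (par v)]eq_sym (negPf (par_par vV vr)) andbF !orbF; apply/negP => /and3P[a pr _].
by have := body_label_par vV vr; rewrite (adj_body_label a) ?eqxx.
Qed.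

Lemma adj_hang_body u v : u \in V -> v \in V -> u != r -> v != r -> u != par v ->
  v != par u -> adj K u v = adj H u v.
Proof.
move=> uV vV ur vr /negPf upv /negPf vpu.
rewrite adj_hang uV vV ur vr upv vpu !andbF !orbF /= andbT.
by case: (boolP (adj H u v)) => [/adj_neq ->|]; rewrite ?andbF.
Qed.

Lemma adj_hang_label u v : u \in V -> v \in V -> u != r -> v != r -> lab u = lab v ->
  adj K u v = adj H u v.
Proof.
move=> uV vV ur vr E; apply: adj_hang_body => //.
  by apply: contraNneq (body_label_par vV vr) => <-; rewrite E.
by apply: contraNneq (body_label_par uV ur) => <-; rewrite E.
Qed.

Lemma body_eq u v : lab u = lab v -> body H r u = body H r v.
Proof. by move=> E; rewrite /body E. Qed.

Lemma hung_block_eq u v : lab u = lab v -> blk u = blk v.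
Proof. by move=> E; rewrite /hung_block (body_eq E) (par_body_label E). Qed.

Lemma body_id v : v \in V -> v != r -> v \in body H r v.
Proof. by rewrite inE => -> ->; rewrite eqxx. Qed.

Lemma par_notin_body v : v \in V -> v != r -> par v \notin body H r v.
Proof. by move=> vV vr; rewrite inE negb_and orbC negb_and body_label_par ?orbT. Qed.

Lemma hung_block_vset_sub v : v \in V -> vset (blk v) \subset V.
Proof.
move=> vV; apply/subsetP => u; rewrite in_setU1 => /predU1P[->|]; first exact: par_V.
by rewrite inE => /andP[].
Qed.

(** The deleted set [X] is empty or a singleton, so that one climbing argument serves the graph and
    its vertex deletions. *)
Let avoid (X : {set T}) G : rel T := fun u w => [&& u \notin X, w \notin X & adj G u w].

Let avoid1 x G : avoid [set x] G =2 adj (del_vertex G x).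
Proof. by move=> u w; rewrite adj_del_vertex /avoid !inE. Qed.

Let avoid0 G : avoid set0 G =2 adj G.
Proof. by move=> u w; rewrite /avoid !inE. Qed.

(** Up to its first visit to [r] a walk of [H] stays in one body, where both graphs agree; its edge
    into [r] becomes an edge into [par v]. *)
Let climb_avoid X v : v \in V -> v != r -> connect (avoid X H) v r -> par v \notin X ->
  connect (avoid X (blk v)) v (par v).
Proof.
move=> vV vr /connectP[s]; elim: s v vV vr => [|w s IH] v vV vr /=.
  by move=> _ E; rewrite E eqxx in vr.
case/andP=> /and3P[vX wX a] pth lE pX.
have wV := adj_vsetr a; have [wr|wr] := eqVneq w r.
  apply: connect1; rewrite /avoid vX pX adj_induced in_setU1 body_id // orbT.
  by rewrite setU11 adj_sym adj_hang_par // adj_sym -wr.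
have E : lab v = lab w by apply: adj_body_label.
have := IH w wV wr pth lE; rewrite -(hung_block_eq E) -(par_body_label E) => /(_ pX).
apply: connect_trans; apply: connect1; rewrite /avoid vX wX adj_induced.
rewrite !in_setU1 body_id // orbT adj_hang_label // a andbT.
by rewrite inE wV wr E eqxx orbT.
Qed.

Lemma climb x v : v \in V -> v != r -> connect (adj (del_vertex H x)) v r -> x != par v ->
  connect (adj (del_vertex (blk v) x)) v (par v).
Proof.
move=> vV vr; rewrite -(eq_connect (avoid1 x H)) -(eq_connect (avoid1 x (blk v))) => con xp.
by apply: climb_avoid; rewrite // inE eq_sym.
Qed.

Lemma climb0 v : v \in V -> v != r -> connect (adj (blk v)) v (par v).
Proof.
move=> vV vr; rewrite -(eq_connect (avoid0 (blk v))); apply: climb_avoid; rewrite ?inE //.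
by rewrite (eq_connect (avoid0 H)); case: flatH => _ /connected_graphP[_ +] _; apply.
Qed.

Lemma flat_connect x v : v \in V -> v != x -> x != r -> connect (adj (del_vertex H x)) v r.
Proof.
move=> vV vx xr; have [_ /connected_graphP[_ con] del] := flatH.
have [xV|xV] := boolP (x \in V).
  by have /connected_graphP[_] := del x xV xr; apply; rewrite in_setD1 ?vx // eq_sym xr.
apply: connect_mono (con v r vV rV) => u w a; rewrite adj_del_vertex a andbT.
by apply/andP; split; apply: contraNneq xV => <-; rewrite ?(adj_vsetl a) ?(adj_vsetr a).
Qed.

Lemma hung_block_sub v : v \in V -> subgraph (blk v) K.
Proof. by move=> vV; apply/subgraph_induced/hung_block_vset_sub. Qed.

(** Without [par v] the body remains, a component of [H - r]. Without another vertex [x], flatness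
    gives walks of [H] to [r] avoiding [x], and these become walks to [par v]. *)
Lemma hung_block_nonseparable v : v \in V -> v != r -> nonseparable (blk v).
Proof.
move=> vV vr; have pB : par v \in vset (blk v) by apply: setU11.
have blkE u : u \in body H r v -> [/\ u \in V, u != r, blk u = blk v & par u = par v].
  by rewrite inE => /and3P[uV ur /eqP E]; rewrite (hung_block_eq E) (par_body_label E).
apply/nonseparableP; split.
  apply: connected_graph_root pB _ => u /setU1P[->|]; first exact: connect0.
  by move=> /blkE[uV ur <- <-]; apply: climb0.
move=> x xB _; have [xp|xp] := eqVneq x (par v); last first.
  have xr : x != r.
    by move: xB; rewrite in_setU1 (negPf xp) inE => /and3P[].
  apply: (@connected_graph_root _ _ (par v)); first by rewrite in_setD1 eq_sym xp.
  move=> u /setD1P[ux /setU1P[->|]]; first exact: connect0.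
  move=> /blkE[uV ur <- pE]; rewrite -pE in xp *; apply: climb => //.
  exact: flat_connect.
have bodyN u : u \in body H r v -> u != x.
  by apply: contraTneq => ->; rewrite xp par_notin_body.
apply: (@connected_graph_root _ _ v).
  by rewrite in_setD1 in_setU1 body_id // orbT bodyN ?body_id.
move=> u /setD1P[ux /setU1P[E|uB]]; first by rewrite E xp eqxx in ux.
have: connect (adj (del_vertex H r)) u v.
  by move: uB; rewrite inE body_label_connect => /and3P[].
move=> uv; pose P w := connect (adj (del_vertex (blk v) x)) u w && (w \in body H r v).
suff /andP[] : P v by [].
refine (@connect_stable _ _ P u v _ uv _); last by rewrite /P connect0.
move=> w w'; rewrite adj_del_vertex => /and3P[wr w'r a] /andP[uw wB].
have w'B : w' \in body H r v.
  rewrite inE (adj_vsetr a) w'r /=; move: wB; rewrite inE => /and3P[_ _ /eqP <-].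
  by rewrite (adj_body_label a).
rewrite /P w'B andbT; apply: connect_trans uw _; apply: connect1.
rewrite adj_del_vertex !bodyN // adj_induced !in_setU1 wB w'B !orbT /=.
by rewrite adj_hang_label ?(adj_vsetl a) ?(adj_vsetr a) ?(adj_body_label a).
Qed.

(* The part of [hang H r par] above the block of [v] is attached at [par v]. *)
Let above v u : bool := [exists w, [&& fconnect par u w & lab w == lab v]].

Let above_id v : above v v.
Proof. by apply/existsP; exists v; rewrite connect0 eqxx. Qed.

Let above_label v u u' : lab u = lab u' -> above v u -> above v u'.
Proof.
move=> E /existsP[w /andP[/fconnect_cases[<-|uw] wv]]; apply/existsP.
  by exists u'; rewrite connect0 -E.
by exists w; rewrite wv andbT; apply: connect_trans (fconnect1 _ _) _; rewrite -(par_body_label E).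
Qed.

Let above_step v u u' : adj K u u' -> above v u -> ~~ above v u' -> u' = par v.
Proof.
rewrite adj_hang => /and4P[_ uV u'V /or3P[/and3P[a ur u'r]|/andP[a /eqP uE]|/andP[a /eqP u'E]]] abu.
- by rewrite (above_label (adj_body_label a ur u'r) abu).
- case/negP; case/existsP: abu => w /andP[uw wv]; apply/existsP; exists w.
  by rewrite wv andbT; apply: connect_trans (fconnect1 _ _) _; rewrite -uE.
- case/existsP: abu => w /andP[/fconnect_cases[<- uv|uw wv]] nab.
    by rewrite u'E; apply/par_body_label/eqP.
  by case/negP: nab; apply/existsP; exists w; rewrite u'E uw.
Qed.

Let above_root v : v != r -> ~~ above v r.
Proof.
move=> vr; apply/existsP => -[w /andP[/(fconnect_root par_r) -> /eqP E]].
by have := body_label_neq vr; rewrite -E body_label_root eqxx.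
Qed.

(** The part above the body of [u] contains [v] but not [r], and it can be left only through
    [par u = x]. *)
Lemma hang_above_disconnect v u x : v \in V -> fconnect par v u -> par u = x -> x != r ->
  ~~ connect (adj (del_vertex K x)) v r.
Proof.
move=> vV vu xE xr; have ur : u != r by apply: contraNneq xr => ur; rewrite -xE ur par_r.
apply: contra (above_root ur) => con.
refine (@connect_stable _ _ (above u) _ _ _ con _) => [s t|].
  rewrite adj_del_vertex => /and3P[_ tx a] abs; apply: contraNT tx => nabt.
  by rewrite (above_step a abs nabt) xE.
by apply/existsP; exists u; rewrite vu eqxx.
Qed.

(** For a deepest vertex [u] of [C], deleting [par u] confines the rest of [C] to the part above the
    body of [u]; as nothing in [C] is deeper than [u], it lies in that body. *)
Lemma hung_block_sup C : nonseparable C -> subgraph C K -> 1 < #|vset C| ->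
  exists v, [/\ v \in V, v != r & subgraph C (blk v)].
Proof.
move=> nsC sCK /card_gt1P[c1 [c2 [c1C c2C c12]]].
have CV : {subset vset C <= V} by apply/subsetP/(subgraph_vset sCK).
have [u uC umax] : exists2 u, u \in vset C & {in vset C, forall w, order par w <= order par u}.
  by case: (arg_maxnP (order par) c1C) => u uC umax; exists u.
have uV := CV u uC.
have ur : u != r.
  have [c cC cr] : exists2 c, c \in vset C & c != r.
    have [c1r|] := eqVneq c1 r; last by exists c1.
    by exists c2 => //; rewrite -c1r eq_sym.
  have := umax c cC; rewrite leqNgt; apply: contraNneq => ->.
  exact: order_root_lt (par_fconnect (CV c cC)) cr.
exists u; split => //; apply: sub_induced => //; apply/subsetP => w wC.
rewrite in_setU1; apply/predU1P; have [->|wp] := eqVneq w (par u); first by left.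
right; have : above u w.
  have con : connect (adj (del_vertex C (par u))) u w.
    by apply: nonseparable_connect => //; rewrite eq_sym par_neq.
  refine (@connect_stable _ _ (above u) _ _ _ con (above_id u)) => x y.
  rewrite adj_del_vertex => /and3P[_ yp a] abx; apply: contraNT yp => naby.
  by apply/eqP/(above_step _ abx naby)/(subgraph_adj sCK a).
move=> /existsP[w' /andP[ww' /eqP E]].
have lab_r := body_label_neq ur.
have w'r : w' != r by apply: contraNneq lab_r => w'r; rewrite -E w'r body_label_root.
have wr := par_fconnect (CV w wC).
have w'V := reach_vset (CV w wC) ww'.
(* [w'] has the same pointer as [u], hence the same depth, while [w] is at most as deep as [u]. *)
have -> : w = w'.
  apply: order_fconnect_eq wr ww' _ => //.
  rewrite (order_next par_r (par_fconnect w'V) w'r) (par_body_label E).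
  by rewrite -(order_next par_r (par_fconnect uV) ur) umax.
by rewrite inE w'V w'r E eqxx.
Qed.

Lemma hung_block_inj u v : u \in V -> u != r -> v \in V -> v != r ->
  vset (blk u) \subset vset (blk v) -> lab u = lab v.
Proof.
move=> uV ur vV vr /subsetP sub.
have bodyE w : w \in body H r v -> lab w = lab v /\ par w = par v.
  by rewrite inE => /and3P[_ _ /eqP E]; rewrite (par_body_label E).
have := sub u; rewrite !in_setU1 body_id // orbT => /(_ isT) /predU1P[uE|/bodyE[]//].
have := sub (par u) (setU11 _ _); rewrite in_setU1 => /predU1P[pE|/bodyE[_ pE]].
  by have := par_neq uV ur; rewrite pE -uE eqxx.
by have := par_par uV ur; rewrite pE -uE eqxx.
Qed.

Lemma hang_connected : connected_graph K.
Proof.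
apply: (@connected_graph_root _ K r rV) => v vV.
have [n le_n] := ubnP (order par v); elim: n => // n IH in v vV le_n *.
have [->|vr] := eqVneq v r; first exact: connect0.
apply: (@connect_trans _ _ (par v)).
  exact: connect_subgraph (hung_block_sub vV) (climb0 vV vr).
apply: IH; first exact: par_V.
by rewrite -ltnS -(order_next par_r (par_fconnect vV) vr).
Qed.

Lemma hang_blocks : 1 < #|V| -> blocks K = [set blk v | v in V :\ r].
Proof.
move=> V1; apply/setP => B; rewrite blocksE; apply/maximal_subgraphP/imsetP.
  move=> [sBK nsB maxB]; have [B1|B1] := ltnP 1 #|vset B|.
    have [v [vV vr sBv]] := hung_block_sup nsB sBK B1.
    exists v; first by rewrite in_setD1 vr.
    by rewrite -(maxB (blk v)) ?hung_block_sub ?hung_block_nonseparable.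
  (* A single vertex is not maximal, since it lies in some [blk v]; for the vertex [r], a neighbour
     supplies [v]. *)
  have /nonseparableP[/connected_graphP[/set0Pn[x xB] _] _] := nsB.
  have BE : vset B = [set x] by apply/eqP; rewrite eq_sym eqEcard sub1set xB cards1.
  have xV : x \in V by apply: (subsetP (subgraph_vset sBK)).
  have [v [vV vr xv]] : exists v, [/\ v \in V, v != r & x \in vset (blk v)].
    have [xr|xr] := eqVneq x r; last by exists x; rewrite xV xr in_setU1 body_id ?orbT.
    have [y yV yx] : exists2 y, y \in V & y != x.
      case/card_gt1P: V1 => y [z [yV zV yz]]; have [yx|] := eqVneq y x; last by exists y.
      by exists z => //; rewrite -yx eq_sym.
    have [|z a] := connected_neighbour hang_connected xV yV _; first by rewrite eq_sym.
    have zr : z != r by rewrite -xr eq_sym (adj_neq a).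
    exists z; rewrite (adj_vsetr a) zr in_setU1; split => //; apply/orP; left.
    move: a; rewrite adj_hang xr eqxx !andbF /= => /and4P[_ _ _ /orP[/andP[_ //]|]].
    by rewrite adj_irr.
  have E : blk v = B.
    apply: maxB; rewrite ?hung_block_sub ?hung_block_nonseparable //.
    apply/subgraphP; split; first by rewrite BE sub1set.
    move=> s t a; move: (adj_vsetl a) (adj_vsetr a) (adj_neq a); rewrite BE !inE.
    by move=> /eqP -> /eqP ->; rewrite eqxx.
  by exists v; rewrite // in_setD1 vr.
move=> [v /setD1P[vr vV] ->]; split; rewrite ?hung_block_sub ?hung_block_nonseparable //.
move=> C sCK nsC svC; have C1 : 1 < #|vset C|.
  apply: (@leq_trans #|[set v; par v]|); first by rewrite cards2 eq_sym par_neq.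
  apply: subset_leq_card; apply: subset_trans (subgraph_vset svC).
  by rewrite subUset !sub1set setU11 in_setU1 body_id ?orbT.
have [u [uV ur sCu]] := hung_block_sup nsC sCK C1.
have E : lab v = lab u.
  by apply: hung_block_inj => //; apply: subset_trans (subgraph_vset svC) (subgraph_vset sCu).
by apply: subgraph_anti => //; rewrite (hung_block_eq E).
Qed.
End Pointers.
End Hanging.

(** * Rooted decomposition into a flat graph and pointers *)

Section Uniqueness.
Variable T : finType.
Implicit Types (G H K B C : graph T) (r x y u v w : T).

(* The ancestors of [v] under [par] are the vertices separating it from [r], so
   they are determined by the graph. *)
Lemma hang_separates H r par v x : flat H r -> pointer H r par ->
  v \in vset H -> x != v -> x != r ->
  connect (adj (del_vertex (hang H r par) x)) v r = ~~ fconnect par v x.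
Proof.
move=> flatH parH vV xv xr; apply/idP/idP => [con|].
  apply: contraL con => /iter_findex; case: (findex _ _ _) => [E|m].
    by rewrite -E eqxx in xv.
  rewrite iterS; set u := iter m par v => xE.
  have vu : fconnect par v u by apply: fconnect_iter.
  exact: (hang_above_disconnect parH vV vu xE xr).
have [n le_n] := ubnP (order par v); elim: n => // n IH in v vV xv le_n * => nx.
have [->|vr] := eqVneq v r; first exact: connect0.
have [par_r parV _ acyc] := parH.
have xp : x != par v by apply: contraNneq nx => ->; apply: fconnect1.
apply: (@connect_trans _ _ (par v)).
  apply: connect_mono (climb parH vV vr (flat_connect flatH vV _ xr) xp); last by rewrite eq_sym.
  move=> s t; rewrite !adj_del_vertex => /and3P[-> -> /=].
  exact: subgraph_adj (hung_block_sub parH vV).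
apply: IH => //; first exact: parV.
  by rewrite -ltnS -(order_next par_r (acyc v vV) vr).
by apply: contra nx; apply: connect_trans (fconnect1 _ _).
Qed.

(** Equal orbits give equal depths, and [par v] is the vertex of the orbit of [v] one level below
    [v]. The edges of [H] at [r] are read off between [v] and [par v]; the other edges are those of
    the hung graph. *)
Lemma hang_inj H H' r par par' : flat H r -> pointer H r par ->
  flat H' r -> pointer H' r par' -> hang H r par = hang H' r par' ->
  H = H' /\ {in vset H, par =1 par'}.
Proof.
move=> flatH parH flatH' parH' E.
have VE : vset H = vset H' by rewrite -(vset_hang H r par) E.
have [par_r parV _ acyc] := parH; have [par'_r par'V _ acyc'] := parH'.
have ancE v : v \in vset H -> fconnect par v =i fconnect par' v.
  move=> vV x; rewrite !inE; have [->|xv] := eqVneq x v; first by rewrite !connect0.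
  have [->|xr] := eqVneq x r; first by rewrite acyc ?acyc' -?VE.
  by apply: negb_inj; rewrite -(hang_separates flatH parH) // E hang_separates // -VE.
have ordE v : v \in vset H -> order par v = order par' v.
  by move=> vV; apply: eq_card => x; rewrite !inE; have := ancE v vV x; rewrite !inE.
have parE : {in vset H, par =1 par'}.
  move=> v vV; have [->|vr] := eqVneq v r; first by rewrite par_r par'_r.
  have v'V : v \in vset H' by rewrite -VE.
  have p'V : par' v \in vset H by rewrite VE par'V.
  apply/esym/(order_fconnect_eq par_r); first exact: acyc.
    have: fconnect par' v (par v) by have := ancE v vV (par v); rewrite !inE fconnect1 => <-.
    case/fconnect_cases => [pE|]; first by have := par_neq parH vV vr; rewrite -pE eqxx.
    by have := ancE _ p'V (par v); rewrite !inE => ->.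
  have := order_next par_r (acyc v vV) vr; rewrite (ordE v vV).
  by rewrite (order_next par'_r (acyc' v v'V) vr) (ordE _ p'V) => -[->].
split=> //; apply: graph_eqP => // u v.
have adj_r w : w \in vset H -> adj H r w = adj H' r w.
  move=> wV; have [->|wr] := eqVneq w r; first by rewrite !adj_irr.
  rewrite -(adj_hang_par parH) // E parE // adj_hang_par // -VE //.
have [uV|uV] := boolP (u \in vset H); last first.
  by apply/idP/idP => /adj_vsetl; rewrite -?VE (negPf uV).
have [vV|vV] := boolP (v \in vset H); last first.
  by apply/idP/idP => /adj_vsetr; rewrite -?VE (negPf vV).
have [->|ur] := eqVneq u r; first exact: adj_r.
have [->|vr] := eqVneq v r; first by rewrite adj_sym adj_r // adj_sym.
have notpar G p : flat G r -> pointer G r p -> adj G u v -> (u != p v) && (v != p u).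
  move=> flatG pG a; have L := adj_body_label a ur vr.
  apply/andP; split.
    by apply: contraNneq (body_label_par pG (adj_vsetr a) vr) => <-; rewrite L.
  by apply: contraNneq (body_label_par pG (adj_vsetl a) ur) => <-; rewrite L.
apply/idP/idP => a.
  have /andP[np np'] := notpar _ _ flatH parH a.
  rewrite -(adj_hang_body (par := par') (r := r)) -?VE -?parE // -E adj_hang_body //.
have [u'V v'V] : u \in vset H' /\ v \in vset H' by rewrite -VE.
have /andP[np np'] := notpar _ _ flatH' parH' a.
by rewrite -(adj_hang_body (par := par) (r := r)) ?parE // E adj_hang_body.
Qed.
End Uniqueness.

Section Isomorphism.
Implicit Types (T U W : finType).

Lemma graph_iso_trans T U W (G : graph T) (H : graph U) (K : graph W) :
  graph_iso G H -> graph_iso H K -> graph_iso G K.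
Proof.
move=> [f fbij fadj] [g gbij gadj]; exists (g \o f); first exact: bij_comp.
by move=> x y; rewrite fadj gadj.
Qed.

Lemma graph_iso_of T (G H : graph T) (f g : T -> T) :
  {in vset G, forall x, f x \in vset H /\ g (f x) = x} ->
  {in vset H, forall x, g x \in vset G /\ f (g x) = x} ->
  {in vset G &, forall x y, adj G x y = adj H (f x) (f y)} -> graph_iso G H.
Proof.
move=> fP gP fadj.
pose F (x : {x | x \in vset G}) : {y | y \in vset H} :=
  exist _ (f (val x)) (proj1 (fP _ (valP x))).
pose F' (x : {x | x \in vset H}) : {y | y \in vset G} :=
  exist _ (g (val x)) (proj1 (gP _ (valP x))).
exists F; last by move=> x y; rewrite fadj ?(valP x) ?(valP y).
exists F' => x; apply: val_inj => /=; first by case: (fP _ (valP x)).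
by case: (gP _ (valP x)).
Qed.
End Isomorphism.

(** * Change of pointers preserves the blocks *)

Section Similarity.
Variables (T : finType) (H : graph T) (r : T).
Hypothesis flatH : flat H r.
Local Notation V := (vset H).

Definition labels : {set T} := [set body_label H r v | v in V :\ r].

Lemma labels_neq i : i \in labels -> i != r.
Proof. by case/imsetP => v /setD1P[vr _] ->; apply: body_label_neq. Qed.

Lemma labels_vset i : i \in labels -> i \in V.
Proof. by case/imsetP => v /setD1P[_ vV] ->; apply: body_label_vset. Qed.

Lemma labels_idem i : i \in labels -> body_label H r i = i.
Proof. by case/imsetP => v _ ->; apply: body_label_idem. Qed.

Lemma hang_blocks_labels par : pointer H r par -> 1 < #|V| ->
  blocks (hang H r par) = [set hung_block H r par i | i in labels].
Proof.
move=> parH V1; rewrite hang_blocks // /labels -imset_comp; apply: eq_in_imset => v _ /=.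
by apply: hung_block_eq => //; rewrite body_label_idem.
Qed.

Lemma hung_block_label_inj par : pointer H r par ->
  {in labels &, injective (hung_block H r par)}.
Proof.
move=> parH i j iL jL E; rewrite -(labels_idem iL) -(labels_idem jL).
by apply: (hung_block_inj parH); rewrite ?labels_vset ?labels_neq // E.
Qed.

Lemma card_hang_blocks par : pointer H r par -> 1 < #|V| ->
  #|blocks (hang H r par)| = #|labels|.
Proof.
by move=> parH V1; rewrite hang_blocks_labels // card_in_imset //; apply: hung_block_label_inj.
Qed.

(** The isomorphism fixes the body and moves the attaching vertex. *)
Lemma hung_block_iso par par' v : pointer H r par -> pointer H r par' ->
  v \in V -> v != r -> graph_iso (hung_block H r par v) (hung_block H r par' v).
Proof.
move=> parH parH' vV vr.
have bodyN p u : pointer H r p -> u \in body H r v -> u != p v.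
  by move=> pH uB; apply: contraTneq uB => ->; apply: par_notin_body.
have adjE p u : pointer H r p -> u \in body H r v ->
    adj (hung_block H r p v) (p v) u = adj H r u.
  move=> pH uB; rewrite adj_induced setU11 in_setU1 uB orbT /=.
  move: uB; rewrite inE => /and3P[uV ur /eqP E].
  by rewrite -(par_body_label pH E) adj_hang_par.
have adjE' p u w : pointer H r p -> u \in body H r v -> w \in body H r v ->
    adj (hung_block H r p v) u w = adj H u w.
  move=> pH uB wB; rewrite adj_induced !in_setU1 uB wB !orbT /=.
  move: uB wB; rewrite !inE => /and3P[uV ur /eqP Eu] /and3P[wV wr /eqP Ew].
  by apply: adj_hang_label => //; rewrite Eu.
apply: (@graph_iso_of _ _ _ (fun u => if u == par v then par' v else u)
                           (fun u => if u == par' v then par v else u)).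
- move=> u /setU1P[->|uB]; first by rewrite !eqxx setU11.
  by rewrite (negPf (bodyN _ _ parH uB)) (negPf (bodyN _ _ parH' uB)) in_setU1 uB orbT.
- move=> u /setU1P[->|uB]; first by rewrite !eqxx setU11.
  by rewrite (negPf (bodyN _ _ parH' uB)) (negPf (bodyN _ _ parH uB)) in_setU1 uB orbT.
move=> u w /setU1P[->|uB] /setU1P[->|wB]; rewrite ?eqxx ?adj_irr //.
- by rewrite (negPf (bodyN _ _ parH wB)) !adjE.
- by rewrite (negPf (bodyN _ _ parH uB)) adj_sym [RHS]adj_sym !adjE.
- by rewrite (negPf (bodyN _ _ parH wB)) (negPf (bodyN _ _ parH uB)) !adjE'.
Qed.

(** Blocks are indexed by bodies for every pointer function, and blocks with the same body are
    isomorphic. *)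
Lemma hang_sim par par' : pointer H r par -> pointer H r par' ->
  sim_connected (hang H r par) (hang H r par').
Proof.
move=> parH parH'; split=> // U X.
have [V1|V1] := ltnP 1 #|V|; last first.
  suff -> : hang H r par = hang H r par' by [].
  apply: graph_eqP => // u v; rewrite !adj_hang; case: eqVneq => //= uv.
  case: (boolP (u \in V)) => //= uV; case: (boolP (v \in V)) => //= vV.
  have /card_le1_eqP/(_ u v uV vV) E := V1.
  by rewrite E eqxx in uv.
have countE p : pointer H r p ->
    #|[set B in blocks (hang H r p) | `[< graph_iso B X >]]| =
    #|[set i in labels | `[< graph_iso (hung_block H r p i) X >]]|.
  move=> pH; rewrite hang_blocks_labels //.
  rewrite -(card_in_imset (f := hung_block H r p)); last first.
    move=> i j; rewrite !inE => /andP[iL _] /andP[jL _].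
    exact: hung_block_label_inj.
  apply: eq_card => B; rewrite inE; apply/andP/imsetP => [[/imsetP[i iL ->] iso]|[i]].
    by exists i; rewrite // inE iL.
  by rewrite inE => /andP[iL iso] ->; rewrite imset_f.
rewrite !countE //; apply: eq_card => i; rewrite !inE.
case: (boolP (i \in labels)) => //= iL; apply/asboolP/asboolP; apply: graph_iso_trans.
  by apply: hung_block_iso => //; rewrite ?labels_vset ?labels_neq.
by apply: hung_block_iso => //; rewrite ?labels_vset ?labels_neq.
Qed.

Lemma pointer_root : pointer H r (fun=> r).
Proof.
have [rV _ _] := flatH; split=> // v _.
exact: (fconnect1 (fun=> r) v).
Qed.
End Similarity.

(** * Flattening by re-attachment at cut vertices *)

Section Flattening.
Variable T : finType.
Implicit Types (G H K : graph T) (r x u v w : T).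

Lemma hang_root H r : hang H r (fun=> r) = H.
Proof.
apply: graph_eqP => // u v; rewrite adj_hang.
case: (boolP (adj H u v)) => [a|na] /=.
  rewrite (adj_neq a) (adj_vsetl a) (adj_vsetr a) /=.
  have [ur|_] := eqVneq u r; first by rewrite -ur a.
  by have [vr|//] := eqVneq v r; rewrite -vr adj_sym a !orbT.
apply/negP => /and4P[_ _ _ /orP[]] /andP[a /eqP E]; first by rewrite E a in na.
by rewrite E adj_sym a in na.
Qed.

(* The vertices that [x] separates from [r] are re-attached at [r]. *)
Lemma flat_step H r par x : r \in vset H -> connected_graph H -> pointer H r par ->
  x \in vset H -> x != r -> ~~ connected_graph (del_vertex H x) ->
  exists H1 par1, [/\ r \in vset H1, connected_graph H1, pointer H1 r par1,
    hang H1 r par1 = hang H r par & [set v | adj H r v] \proper [set v | adj H1 r v]].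
Proof.
move=> rV conH [par_r parV parA acyc] xV xr cutx.
have /connected_graphP[_ con] := conH.
pose Y := [set v in vset H | (v != x) && ~~ connect (adj (del_vertex H x)) v r].
have xY : x \notin Y by rewrite inE eqxx andbF.
have rY : r \notin Y by rewrite inE connect0 !andbF.
have YV : {subset Y <= vset H} by move=> v; rewrite inE => /andP[].
have Yedge u v : adj H u v -> u \in Y -> v \notin Y -> v = x.
  move=> a; rewrite !inE (adj_vsetl a) (adj_vsetr a) /= => /andP[ux nur].
  apply: contraNeq => vx; rewrite vx; apply: contra nur => vr.
  by apply: connect_trans vr; apply: connect1; rewrite adj_del_vertex ux vx.
have Yedge' u v : adj H u v -> v \in Y -> u \notin Y -> u = x.
  by rewrite adj_sym; apply: Yedge.
have rYN y : y \in Y -> adj H r y = false.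
  by move=> yY; apply/negP => /Yedge' /(_ yY rY) rx; rewrite rx eqxx in xr.
(* The edges between [x] and the separated set [Y] are replaced by edges from [r] to the same
   vertices of [Y]. *)
pose cross u v := (u \in Y) && (v == x) || (v \in Y) && (u == x).
pose e u v := [|| adj H u v && ~~ cross u v,
  [&& u == r, v \in Y & adj H x v] | [&& v == r, u \in Y & adj H x u]].
pose H1 := relgraph (vset H) e.
have eC u v : e u v = e v u.
  rewrite /e /cross [adj H v u]adj_sym.
  by case: (adj H u v); case: (u \in Y); case: (v \in Y); case: (u == x); case: (v == x);
     case: (u == r); case: (v == r); case: (adj H x u); case: (adj H x v).
have aH1 u v : adj H1 u v = [&& u != v, u \in vset H, v \in vset H & e u v].
  by rewrite adj_relgraph -eC orbb.
have keep u v : adj H u v -> ~~ cross u v -> adj H1 u v.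
  by move=> a nc; rewrite aH1 (adj_neq a) (adj_vsetl a) (adj_vsetr a) /e a nc.
have hook y : y \in Y -> adj H x y -> adj H1 r y.
  move=> yY a; rewrite aH1 rV (adj_vsetr a) /e eqxx yY a orbT !andbT.
  by apply: contraNneq rY => ->.
have nY_con v : v \in vset H -> v != x -> v \notin Y -> connect (adj H1) r v.
  move=> vV vx; rewrite inE vV vx /= negbK => vr.
  pose P w := connect (adj H1) r w && connect (adj (del_vertex H x)) r w.
  suff /andP[] : P v by [].
  rewrite connect_adj_sym in vr.
  refine (@connect_stable _ _ P r v _ vr _); last by rewrite /P !connect0.
  move=> w w' a' /andP[rw rw']; have := a'; rewrite adj_del_vertex => /and3P[wx w'x a].
  have rw'' := connect_trans rw' (connect1 a').
  rewrite /P rw'' andbT; apply: connect_trans rw (connect1 _); apply: keep => //.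
  by rewrite /cross (negPf wx) (negPf w'x) !andbF.
have x_con : connect (adj H1) r x.
  apply: contraT => nx; pose P w := (w \in Y) || (w == x).
  have : P r; last by rewrite /P (negPf rY) eq_sym (negPf xr).
  refine (@connect_stable _ _ P x r _ (con x r xV rV) _); last by rewrite /P eqxx orbT.
  move=> w w' a; rewrite /P; have [w'Y //|w'Y] := boolP (w' \in Y).
  case/orP => [wY|/eqP wx]; first by rewrite (Yedge _ _ a wY w'Y) eqxx.
  have w'x : w' != x by rewrite -wx eq_sym (adj_neq a).
  case/negP: nx; apply: connect_trans (nY_con w' (adj_vsetr a) w'x w'Y) (connect1 _).
  rewrite -wx adj_sym; apply: keep => //.
  by rewrite /cross wx (negPf xY) (negPf w'Y).
have Y_con v : v \in Y -> connect (adj H1) r v.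
  move=> vY; apply: contraT => nv; pose P w := (w \in Y) && connect (adj H1) v w.
  have : P r; last by rewrite /P (negPf rY).
  refine (@connect_stable _ _ P v r _ (con v r (YV v vY) rV) _); last by rewrite /P vY connect0.
  move=> w w' a /andP[wY vw]; have [w'Y|w'Y] := boolP (w' \in Y).
    rewrite /P w'Y; apply: connect_trans vw (connect1 (keep _ _ a _)).
    by rewrite /cross wY w'Y /= negb_or; apply/andP; split; apply: contraNneq xY => <-.
  have w'x := Yedge _ _ a wY w'Y; case/negP: nv; rewrite connect_adj_sym.
  apply: connect_trans vw (connect1 _); rewrite adj_sym; apply: hook => //.
  by rewrite -w'x adj_sym.
have conH1 : connected_graph H1.
  apply: (@connected_graph_root _ H1 r rV) => v vV; rewrite connect_adj_sym.
  have [/Y_con//|vY] := boolP (v \in Y); have [->//|vx] := eqVneq v x.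
  exact: nY_con.
have [y yY ay] : exists2 y, y \in Y & adj H x y.
  have [v vY] : exists v, v \in Y.
    apply/set0Pn; apply: contra cutx => /eqP Y0.
    apply: (@connected_graph_root _ _ r); first by rewrite in_setD1 eq_sym xr.
    move=> v /setD1P[vx vV]; have : v \notin Y by rewrite Y0 inE.
    by rewrite inE vV vx negbK.
  apply/exists_inP; apply: contraNT rY => /exists_inPn nY.
  refine (@connect_stable _ _ (mem Y) v r _ (con v r (YV v vY) rV) vY) => w w' a wY.
  apply: contraT => w'Y; have := nY w wY.
  by rewrite -(Yedge _ _ a wY w'Y) adj_sym a.
pose par1 v := if v \in Y then x else par v.
(* [Y] can be left towards [r] only through [x], and pointers are constant along edges avoiding
   [r]. *)
have par_Y v : v \in Y -> par v = par x.
  move=> vY; apply/eqP; apply: (contraNT _ rY) => npar.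
  pose P w := (w \in Y) && (par w == par v).
  suff /andP[] : P r by [].
  refine (@connect_stable _ _ P v r _ (con v r (YV v vY) rV) _); last by rewrite /P vY eqxx.
  move=> w w' a /andP[wY /eqP pw].
  have wr : w != r by apply: contraNneq rY => <-.
  have [w'Y|w'Y] := boolP (w' \in Y).
    have w'r : w' != r by apply: contraNneq rY => <-.
    by rewrite /P w'Y -pw (parA _ _ a wr w'r) eqxx.
  case/eqP: npar; rewrite -pw -(Yedge _ _ a wY w'Y); apply: (parA _ _ a wr).
  by rewrite (Yedge _ _ a wY w'Y).
exists H1, par1; split => //.
- split=> [|v vV|u v|v vV]; rewrite /par1.
  + by rewrite (negPf rY).
  + by case: ifP => // _; apply: parV.
  + rewrite aH1 /e => /and4P[_ _ _ +] ur vr; rewrite (negPf ur) (negPf vr) !andFb !orbF.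
    move=> /andP[a nc]; have [uY|uY] := boolP (u \in Y).
      have [//|vY] := boolP (v \in Y).
      by move: nc; rewrite /cross uY (Yedge _ _ a uY vY) eqxx.
    have [vY|vY] := boolP (v \in Y); last exact: parA a ur vr.
    by move: nc; rewrite /cross vY (Yedge' _ _ a vY uY) eqxx orbT.
  (* A step from [v] in [Y] to [par v] becomes two steps, to [x] and then to [par x = par v]. *)
  + have /iter_findex := acyc v vV; move: (findex _ _ _) => m.
    elim: m v vV => [|m IH] v vV; first by move=> /= ->; apply: connect0.
    have [->|vr] := eqVneq v r; first by rewrite connect0.
    rewrite iterSr; have [vY|vY] := boolP (v \in Y) => itr.
      apply: connect_trans (fconnect1 _ v) _; rewrite /= vY.
      apply: connect_trans (fconnect1 _ x) _; rewrite /= (negPf xY).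
      by apply: IH; [exact: parV|rewrite -(par_Y v vY)].
    apply: connect_trans (fconnect1 _ v) _; rewrite /= (negPf vY).
    by apply: IH; rewrite ?parV.
- apply: graph_eqP => // u v; rewrite !adj_hang; case: eqVneq => //= uv.
  case: (boolP (u \in vset H)) => //= uV; case: (boolP (v \in vset H)) => //= vV.
  have rE w : w \in vset H -> adj H1 r w = if w \in Y then adj H x w else adj H r w.
    move=> wV; have [->|wr] := eqVneq w r; first by rewrite (negPf rY) !adj_irr.
    rewrite aH1 eq_sym wr rV wV /e /cross eqxx (negPf rY) [r == x]eq_sym (negPf xr).
    rewrite (negPf wr) !andFb !orbF !andbF /= andbT.
    by have [/rYN ->|] := boolP (w \in Y); rewrite ?orbF.
  have nrE : [&& adj H1 u v, u != r & v != r] = [&& adj H u v, ~~ cross u v, u != r & v != r].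
    have [ur|ur] := eqVneq u r; rewrite ?andbF //.
    have [vr|vr] := eqVneq v r; rewrite ?andbF //.
    by rewrite aH1 uv uV vV /e (negPf ur) (negPf vr) !andFb !orbF !andbT.
  have Yr w : w \in Y -> w != r by apply: contraTneq => ->.
  have Yx w : w \in Y -> w != x by apply: contraTneq => ->.
  rewrite nrE !rE // /cross /par1.
  have [uY|uY] := boolP (u \in Y); have [vY|vY] := boolP (v \in Y) => /=.
  + by rewrite (negPf (Yx u uY)) (negPf (Yx v vY)) !rYN // !andbF.
  + rewrite (rYN u uY) (Yr u uY) orbF andFb orbF.
    have [vx|vx] := eqVneq v x; first by rewrite vx xr !andbT !andbF orFb orbC adj_sym.
    by rewrite andbF orbF.
  + rewrite (rYN v vY) (Yr v vY) andFb !andbT.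
    have [ux|ux] := eqVneq u x; first by rewrite ux xr !andbT !andbF.
    by rewrite andbF.
  + by [].
- apply/properP; split.
    apply/subsetP => v; rewrite !inE => a; apply: keep a _.
    by rewrite /cross (negPf rY) [r == x]eq_sym (negPf xr) andbF.
  by exists y; rewrite inE ?rYN // hook.
Qed.

(** Starting from [K] with all pointers at [r], every cut vertex other than [r] permits a flattening
    step; the neighbourhood of [r] grows strictly, so this ends. *)
Lemma exists_flat K r : connected_graph K -> r \in vset K ->
  exists H par, [/\ flat H r, pointer H r par & hang H r par = K].
Proof.
move=> conK rK; pose nbr G := [set v | adj G r v].
suff gen n H par : #|T| - #|nbr H| < n -> r \in vset H -> connected_graph H ->
    pointer H r par -> hang H r par = K ->
    exists H par, [/\ flat H r, pointer H r par & hang H r par = K].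
  apply: (gen _ K (fun=> r) (ltnSn _)) => //; last exact: hang_root.
  by split=> // v _; apply: (fconnect1 (fun=> r) v).
elim: n H par => // n IH H par ltn rV conH parH hE.
have [/forall_inP flatH|] := boolP [forall x in vset H, (x != r) ==> connected_graph (del_vertex H x)].
  by exists H, par; split=> //; split=> // x xV; apply/implyP/flatH.
case/forall_inPn => x xV; rewrite negb_imply => /andP[xr cutx].
have [H1 [par1 [rV1 conH1 parH1 hE1 lt1]]] := flat_step rV conH parH xV xr cutx.
apply: (IH H1 par1) => //; last by rewrite hE1.
have := proper_card lt1; have := max_card (nbr H1); rewrite -/(nbr H) -/(nbr H1).
by move: ltn; lia.
Qed.

End Flattening.

(** * Walks in the block tree *)

Lemma bigminn_le (I : eqType) (s : seq I) (P : pred I) (F : I -> nat) a i :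
  P i -> i \in s -> \big[minn/a]_(j <- s | P j) F j <= F i.
Proof.
move=> Pi; elim: s => // j s IH; rewrite in_cons big_cons => /predU1P[<-|/IH le].
  by rewrite Pi geq_minl.
by case: ifP => // _; rewrite geq_min le orbT.
Qed.

Section Walks.
Variable T : finType.
Implicit Types (G : graph T) (x y z : T) (m n : nat).

Definition walk_le G m x y : Prop :=
  exists p, [/\ path (adj G) x p, last x p = y & size p <= m].

Lemma walk_le0 G m x : walk_le G m x x.
Proof. by exists [::]. Qed.

Lemma walk_le1 G m x y : adj G x y -> walk_le G m.+1 x y.
Proof. by move=> a; exists [:: y]; rewrite /= a. Qed.

Lemma walk_le_cat G m n x y z : walk_le G m x y -> walk_le G n y z -> walk_le G (m + n) x z.
Proof.
move=> [p [pth1 <- le1]] [q [pth2 <- le2]]; exists (p ++ q).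
by rewrite cat_path pth1 last_cat size_cat leq_add.
Qed.

Lemma walk_le_sym G m x y : walk_le G m x y -> walk_le G m y x.
Proof.
move=> [p [pth <- le_m]]; exists (rev (belast x p)); split.
- by rewrite rev_path; apply: sub_path pth => u v; rewrite adj_sym.
- by case: p pth le_m => // z p _ _; rewrite /= rev_cons last_rcons.
- by rewrite size_rev size_belast.
Qed.

Lemma walk_leW G m n x y : m <= n -> walk_le G m x y -> walk_le G n x y.
Proof. by move=> le_mn [p [? ? le]]; exists p; split=> //; apply: leq_trans le_mn. Qed.

Lemma walk_le_mono G G' m x y : (forall u v, adj G u v -> adj G' u v) ->
  walk_le G m x y -> walk_le G' m x y.
Proof. by move=> sub [p [pth ? ?]]; exists p; split=> //; apply: sub_path pth. Qed.

Lemma dist_le G m x y : walk_le G m x y -> dist G x y <= m.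
Proof.
move=> [p [pth lE le_m]]; apply: leq_trans le_m; rewrite /dist.
(* A walk too long for the range of the minimum is covered by the default value [#|T|]. *)
have [lt|le] := ltnP (size p) #|T|; last first.
  apply: leq_trans le; apply: (big_ind (fun k => k <= #|T|)) => // [a b la lb|i _].
    by rewrite geq_min la.
  exact: ltnW.
have w : has_walk G x y (Ordinal lt).
  by apply/existsP; exists (in_tuple p); rewrite /= pth lE eqxx.
exact: (@bigminn_le _ _ (fun k : 'I_#|T| => has_walk G x y k) (@nat_of_ord _) #|T| _ w
          (mem_index_enum _)).
Qed.

Lemma diam_le G m :
  (forall C, C \in components G -> {in vset C &, forall x y, walk_le G m x y}) ->
  diam G <= m.
Proof.
move=> H; apply/bigmax_leqP => C CG; apply/bigmax_leqP => x xC; apply/bigmax_leqP => y yC.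
exact/dist_le/(H C).
Qed.
End Walks.

Definition wide (T : finType) (m : nat) (K : graph T) : Prop :=
  exists x y, [/\ x \in vset (block_tree K), y \in vset (block_tree K) &
                 ~ walk_le (block_tree K) m x y].

Section BlockTreeWalks.
Variable T : finType.
Implicit Types (K B : graph T) (v : T).

Lemma in_block_tree_l K v : (inl v \in vset (block_tree K)) = (v \in vset K).
Proof.
rewrite in_setU (mem_imset _ _ (@inl_inj _ _)) orbC.
by have /negPf -> : inl v \notin [set inr B | B in blocks K] by apply/imsetP => -[].
Qed.

Lemma in_block_tree_r K B : (inr B \in vset (block_tree K)) = (B \in blocks K).
Proof.
rewrite in_setU (mem_imset _ _ (@inr_inj _ _)).
by have /negPf -> : inr B \notin [set inl v | v in vset K] by apply/imsetP => -[].
Qed.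

Lemma adj_block_tree K v B : v \in vset K -> B \in blocks K -> v \in vset B ->
  adj (block_tree K) (inl v) (inr B).
Proof.
move=> vK BK vB; rewrite adj_mkgraph.
have := in_block_tree_l K v; rewrite vK => ->; have := in_block_tree_r K B; rewrite BK => -> /=.
by apply/imset2P; exists v B => //; rewrite inE BK.
Qed.

Lemma not_wide_small K m : connected_graph K -> #|vset K| <= 1 -> 1 < m -> ~ wide m K.
Proof.
move=> /connected_graphP[/set0Pn[r rK] _] K1 m1 [x [y [xK yK]]]; case.
suff near z : z \in vset (block_tree K) -> walk_le (block_tree K) 1 z (inl r).
  by apply: walk_leW (walk_le_cat (near x xK) (walk_le_sym (near y yK))).
have KE v : v \in vset K -> v = r by move=> vK; apply: (card_le1_eqP K1).
case: z => [v|B]; first by rewrite in_block_tree_l => /KE ->; apply: walk_le0.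
rewrite in_block_tree_r => BK; apply/walk_le_sym/walk_le1/adj_block_tree => //.
move: BK; rewrite blocksE => /maximal_subgraphP[sBK /nonseparableP[/connected_graphP[/set0Pn[v vB] _] _] _].
by rewrite -(KE v) // (subsetP (subgraph_vset sBK)).
Qed.
End BlockTreeWalks.

(** * Acyclic functions of a flat graph and distances in block trees *)

Section Fibre.
Variables (T : finType) (H : graph T) (r : T).
Hypothesis flatH : flat H r.
Local Notation V := (vset H).
Local Notation lab := (body_label H r).
Local Notation D := (labels H r).

(** Only the values on the representatives in [labels H r] matter; all others are set to [r], so
    that functions and pointers correspond one to one. *)
Definition fibre : {set {ffun T -> T}} := acyc_fam r V lab D [ffun=> r].

Definition assemble (p : {ffun T -> T}) : graph T := hang H r (fun v => p (lab v)).

Let rV : r \in V. Proof. by case: flatH. Qed.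

Let rD : r \notin D.
Proof. by apply/negP => /(labels_neq); rewrite eqxx. Qed.

Let labD v : v \in V -> v != r -> lab v \in D.
Proof. by move=> vV vr; apply: imset_f; rewrite in_setD1 vr. Qed.

Lemma fibre_labelling : labelling r V lab D.
Proof.
split=> // v vV; rewrite in_setU1; have [->|vr] := eqVneq v r.
  by rewrite body_label_root eqxx.
by rewrite labD ?orbT.
Qed.

(** The label map carries orbits of vertices to orbits under [pstep], and only [r] has label [r]. *)
Lemma fibre_pointer p : p \in fibre -> pointer H r (fun v => p (lab v)).
Proof.
move=> /acyc_famP[pV pq acyc]; have pr : p (lab r) = r.
  by rewrite body_label_root pq // ffunE.
split=> //.
- by move=> v vV; have [->|vr] := eqVneq v r; [rewrite pr|apply/pV/labD].
- by move=> u v a ur vr; rewrite (adj_body_label a ur vr).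
move=> v vV; have [->|vr] := eqVneq v r; first exact: connect0.
have stepE w : pstep r lab p (lab w) = lab (p (lab w)).
  rewrite /pstep; case: eqP => // wr.
  have -> : w = r by apply: contra_eq wr => /body_label_neq.
  by rewrite pr body_label_root.
have /iter_findex := acyc _ (labD vV vr); move: (findex _ _ _) => m.
have -> : iter m (pstep r lab p) (lab v) = lab (iter m (fun v => p (lab v)) v).
  by elim: m => //= m ->; rewrite stepE.
move=> E; have E' : iter m (fun v => p (lab v)) v = r.
  by apply: contra_eq E => /body_label_neq.
by have := fconnect_iter (fun v => p (lab v)) m v; rewrite E'.
Qed.

Lemma eq_hang par par' : {in V, par =1 par'} -> hang H r par = hang H r par'.
Proof.
move=> E; apply: graph_eqP => // u v; rewrite !adj_hang.
case: eqVneq => //= _; case: (boolP (u \in V)) => //= uV.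
by case: (boolP (v \in V)) => //= vV; rewrite !E.
Qed.

Lemma pointer_fibre par : pointer H r par -> exists2 p, p \in fibre & assemble p = hang H r par.
Proof.
move=> parH; have [par_r parV _ acyc] := parH.
pose p := [ffun i => if i \in D then par i else r].
have pE v : v \in V -> p (lab v) = par v.
  move=> vV; rewrite ffunE; have [->|vr] := eqVneq v r.
    by rewrite body_label_root (negPf rD) par_r.
  by rewrite labD // par_lab.
exists p; last by apply: eq_hang => v /pE.
apply/acyc_famP; split=> [i iD|i iD|i iD].
- by rewrite ffunE iD; apply/parV/(labels_vset iD).
- by rewrite !ffunE (negPf iD).
have iV := labels_vset iD.
have stepE w : w \in V -> pstep r lab p (lab w) = lab (par w).
  move=> wV; rewrite /pstep pE //; case: eqP => // wr.
  have -> : w = r by apply: contra_eq wr => /body_label_neq.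
  by rewrite par_r body_label_root.
have /iter_findex := acyc _ iV; move: (findex _ _ _) => m E.
have itV k : iter k par i \in V by elim: k => //= k; apply: parV.
have : iter m (pstep r lab p) (lab i) = lab (iter m par i).
  by elim: (m) => //= k ->; rewrite stepE.
rewrite E body_label_root (labels_idem iD) => E'.
by have := fconnect_iter (pstep r lab p) m i; rewrite E'.
Qed.

Lemma assemble_inj : {in fibre &, injective assemble}.
Proof.
move=> p p' pF pF' E.
have [_ parE] := hang_inj flatH (fibre_pointer pF) flatH (fibre_pointer pF') E.
have /acyc_famP[_ pq _] := pF; have /acyc_famP[_ pq' _] := pF'.
apply/ffunP => i; have [iD|iD] := boolP (i \in D); last by rewrite pq // pq'.
by have := parE i (labels_vset iD); rewrite labels_idem.
Qed.

Section Distance.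
Variable p : {ffun T -> T}.
Hypotheses (pF : p \in fibre) (V1 : 1 < #|V|).
Local Notation K := (assemble p).
Local Notation blk := (hung_block H r (fun v => p (lab v))).
Local Notation step := (pstep r lab p).
Local Notation ancs := (anc r lab p).

Let node i : (T + graph T)%type := if i == r then inl r else inr (blk i).

Let stepr : step r = r. Proof. by rewrite /pstep eqxx. Qed.

Let blkK i : i \in D -> blk i \in blocks K.
Proof. by move=> iD; rewrite (hang_blocks_labels flatH (fibre_pointer pF)) ?imset_f. Qed.

Let step_D i : i \in r |: D -> step i \in r |: D.
Proof.
rewrite in_setU1 => /predU1P[->|iD]; first by rewrite stepr setU11.
rewrite /pstep; case: eqP => _; first exact: setU11.
by have [_] := fibre_labelling; apply; have /acyc_famP[pV _ _] := pF; apply: pV.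
Qed.

(** The walk leads from the block to its attaching vertex [p i], and on to the block whose body
    contains [p i]; it stops early at [p i = r]. *)
Let walk_le_step i : i \in r |: D -> walk_le (block_tree K) 2 (node i) (node (step i)).
Proof.
rewrite in_setU1 => /predU1P[->|iD]; first by rewrite stepr; apply: walk_le0.
have ir := labels_neq iD; have pV : p i \in V by have /acyc_famP[+ _ _] := pF; apply.
have pB : p i \in vset (blk i) by rewrite in_setU1 labels_idem // eqxx.
rewrite /node (negPf ir) /pstep (negPf ir); have [pr|pr] := eqVneq (p i) r.
  rewrite pr body_label_root eqxx; apply/walk_le_sym/walk_le1.
  by rewrite pr in pB; apply: adj_block_tree; rewrite ?blkK.
rewrite (negPf (body_label_neq H pr)).
apply: (@walk_le_cat _ _ 1 1 _ (inl (p i))).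
  by apply/walk_le_sym/walk_le1/adj_block_tree; rewrite ?blkK.
apply/walk_le1/adj_block_tree; rewrite ?blkK ?labD //.
by rewrite in_setU1 inE pV pr body_label_idem eqxx orbT.
Qed.

Let acyc i : i \in r |: D -> fconnect step i r.
Proof.
rewrite in_setU1 => /predU1P[->|iD]; first exact: connect0.
by have /acyc_famP[_ _] := pF; apply.
Qed.

Let anc_step i : i != r -> ancs i = i |: ancs (step i).
Proof.
move=> ir; apply/setP => j; rewrite !inE; have [->|ji] := eqVneq j i.
  by rewrite ir connect0.
have [//|jr] := eqVneq j r; rewrite /=; apply/idP/idP; last first.
  by apply: connect_trans; apply: fconnect1.
by case/fconnect_cases => // ij; rewrite ij eqxx in ji.
Qed.

Let notin_anc_step i : i \in r |: D -> i != r -> i \notin ancs (step i).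
Proof.
move=> iD ir; rewrite !inE ir /=; apply: contraNN ir => con.
by apply/eqP/(fconnect_no_cycle stepr (acyc iD)).
Qed.

(** A label other than [r] that is not on the root path of the other label moves one step, which
    removes it from the union and costs two edges. If neither can move, the labels coincide. *)
Lemma walk_le_anc i j : i \in r |: D -> j \in r |: D ->
  walk_le (block_tree K) (2 * #|ancs i :|: ancs j|) (node i) (node j).
Proof.
have [n] := ubnP #|ancs i :|: ancs j|; elim: n i j => // n IH.
have half i j : #|ancs i :|: ancs j| < n.+1 -> i \in r |: D -> j \in r |: D ->
    i != r -> i \notin ancs j ->
    walk_le (block_tree K) (2 * #|ancs i :|: ancs j|) (node i) (node j).
  move=> lt iD jD ir ij; have E : #|ancs i :|: ancs j| = #|ancs (step i) :|: ancs j|.+1.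
    by rewrite (anc_step ir) -setUA cardsU1 in_setU negb_or notin_anc_step ?ij.
  rewrite E mulnS; apply: walk_le_cat (walk_le_step iD) (IH _ _ _ _ jD); last exact: step_D.
  by rewrite -ltnS -E.
move=> i j lt iD jD; have [ir|ir] := boolP ((i != r) && (i \notin ancs j)).
  by case/andP: ir => ir ij; apply: half.
have [jr|jr] := boolP ((j != r) && (j \notin ancs i)).
  by case/andP: jr => jr ji; rewrite setUC in lt *; apply/walk_le_sym/half.
suff -> : i = j by apply: walk_le0.
move: ir jr; rewrite !negb_and !negbK.
have anc_r : ancs r = set0 by apply: anc_root.
have [->|ir] := eqVneq i r; first by rewrite anc_r in_set0 orbF => _ /eqP ->.
have [->|jr] := eqVneq j r; first by rewrite anc_r in_set0.
rewrite !inE /= => /andP[_ ji] /andP[_ ij].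
apply: (order_fconnect_eq stepr (acyc iD) ij); exact: order_fconnect.
Qed.

(** Every node of the block tree is within one edge of some [node i], so a union of at most [m + 1]
    labels gives walks of length at most [1 + 2 (m + 1) + 1]. *)
Lemma wide_anc m : wide (2 * m).+4 K ->
  exists i j, [/\ i \in D, j \in D & m.+1 < #|ancs i :|: ancs j|].
Proof.
move=> [x [y [xK yK nw]]].
have nodeP z : z \in vset (block_tree K) ->
    exists2 i, i \in r |: D & walk_le (block_tree K) 1 z (node i).
  case: z => [v|B].
    rewrite in_block_tree_l => vV; have [->|vr] := eqVneq v r.
      by exists r; [exact: setU11|rewrite /node eqxx; apply: walk_le0].
    exists (lab v); first by rewrite in_setU1 labD ?orbT.
    rewrite /node (negPf (body_label_neq H vr)); apply/walk_le1/adj_block_tree => //.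
      by rewrite blkK ?labD.
    by rewrite in_setU1 inE vV vr body_label_idem eqxx orbT.
  rewrite in_block_tree_r (hang_blocks_labels flatH (fibre_pointer pF)) // => /imsetP[i iD ->].
  exists i; first by rewrite in_setU1 iD orbT.
  by rewrite /node (negPf (labels_neq iD)); apply: walk_le0.
have [i iD wi] := nodeP x xK; have [j jD wj] := nodeP y yK.
have lt : m.+1 < #|ancs i :|: ancs j|.
  rewrite ltnNge; apply/negP => le; apply: nw.
  apply: walk_leW (walk_le_cat wi (walk_le_cat (walk_le_anc iD jD) (walk_le_sym wj))).
  lia.
have anc_r : ancs r = set0 by apply: anc_root.
(* The label [r] has an empty root path, so the other label can be taken twice. *)
move: iD jD lt; rewrite !in_setU1 => /predU1P[->|iD] /predU1P[->|jD].
- by rewrite anc_r setU0 cards0.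
- by rewrite anc_r set0U => lt; exists j, j; rewrite setUid.
- by rewrite anc_r setU0 => lt; exists i, i; rewrite setUid.
- by exists i, j.
Qed.
End Distance.

Lemma card_fibre_wide m : 1 < #|V| ->
  #|[set p in fibre | `[< wide (2 * m).+4 (assemble p) >]]| * #|D| ^ m <=
  #|D| ^ 2 * (m.+2 * #|D| ^_ m * #|fibre|).
Proof.
move=> V1.
pose S i j := [set p in fibre | m.+1 < #|anc r lab p i :|: anc r lab p j|].
apply: (@leq_trans ((\sum_(i in D) \sum_(j in D) #|S i j|) * #|D| ^ m)).
  rewrite leq_mul2r; apply/orP; right.
  apply: (@leq_trans #|\bigcup_(ij in setX D D) S ij.1 ij.2|).
    apply: subset_leq_card; apply/subsetP => p; rewrite in_sep => /andP[pF /asboolP].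
    move=> /(wide_anc pF V1)[i [j [iD jD lt]]]; apply/bigcupP; exists (i, j).
      by rewrite in_setX iD.
    by rewrite in_sep pF.
  rewrite (eq_bigl (fun ij => (ij.1 \in D) && (ij.2 \in D))); last first.
    by move=> [i j]; rewrite in_setX.
  rewrite pair_big /=.
  apply: (big_ind2 (fun (A : {set _}) n => #|A| <= n)); rewrite ?cards0 // => A a B b leA leB.
  by apply: leq_trans (leq_add leA leB); rewrite cardsU leq_subr.
rewrite -mulnn -mulnA -!sum_nat_const big_distrl; apply: leq_sum => i iD.
rewrite big_distrl; apply: leq_sum => j jD; apply: card_ancU_ge_pr => //.
exact: fibre_labelling.
Qed.
End Fibre.

(** * Connected classes and joins of components *)

From mathcomp Require Import all_order all_algebra.

Import Order.TTheory GRing.Theory Num.Theory.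
Local Open Scope ring_scope.

Section ConnectedClass.
Variables (R : realFieldType) (T : finType).
Implicit Types (K H G C F : graph T).

(** The union bound over the [k ^ 2] pairs of bodies, as a fraction of a fibre whose graphs have [k]
    blocks. *)
Definition wide_weight (m k : nat) : R := (m.+2 * k ^ 2 * k ^_ m)%:R / (k ^ m)%:R.

Lemma wide_weight_ge0 m k : 0 <= wide_weight m k.
Proof. by rewrite divr_ge0 ?ler0n. Qed.

Lemma sim_connected_refl K : sim_connected K K. Proof. by []. Qed.

Variables (A : {set graph T}) (W : {set T}).
Hypothesis A_graph : {in A, forall K, connected_graph K /\ vset K = W}.
Hypothesis A_sim : forall K K', K \in A -> connected_graph K' -> sim_connected K' K -> K' \in A.

Let flats r := [set H in A | `[< flat H r >]].

Let fibre_A r H p : H \in flats r -> p \in fibre H r -> assemble H r p \in A.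
Proof.
rewrite inE => /andP[HA /asboolP flatH] pF; have pH := fibre_pointer flatH pF.
apply: (A_sim HA); first exact: hang_connected.
rewrite -[X in sim_connected _ X](hang_root H r); apply: hang_sim => //.
exact: pointer_root.
Qed.

(** Each [K] in [A] lies in the fibre of exactly one flat graph in [A]: existence is [exists_flat],
    uniqueness is [hang_inj]. *)
Let sum_fibres r (f : graph T -> R) : r \in W ->
  \sum_(K in A) f K = \sum_(H in flats r) \sum_(p in fibre H r) f (assemble H r p).
Proof.
move=> rW.
(* The default value [K] does not occur for [K] in [A]. *)
pose h K := odflt K [pick H in flats r | K \in assemble H r @: fibre H r].
have hP K : K \in A -> h K \in flats r /\ K \in assemble (h K) r @: fibre (h K) r.
  move=> KA; rewrite /h; case: pickP => [H /andP[]//|none].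
  have [conK KW] := A_graph KA; have rK : r \in vset K by rewrite KW.
  have [H [par [flatH parH hE]]] := exists_flat conK rK.
  have [p pF pE] := pointer_fibre parH.
  have HA : H \in A.
    apply: (A_sim KA); first by case: flatH.
    rewrite -hE -[X in sim_connected X _](hang_root H r); apply: hang_sim => //.
    exact: pointer_root.
  have := none H; rewrite inE HA (introT (asboolP _) flatH) -hE -pE imset_f //.
have h_uniq H K : H \in flats r -> K \in assemble H r @: fibre H r -> h K = H.
  move=> HF /imsetP[p pF KE].
  have [hF /imsetP[p' pF' KE']] := hP K (eq_ind_r (fun X => X \in A) (fibre_A HF pF) KE).
  move: HF hF; rewrite !inE => /andP[_ /asboolP flatH] /andP[_ /asboolP flatH'].
  have [] // := hang_inj flatH' (fibre_pointer flatH' pF') flatH (fibre_pointer flatH pF).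
  by rewrite -/(assemble _ _ _) -KE' KE.
rewrite (partition_big h (mem (flats r))) /=; last by move=> K /hP[].
apply: eq_bigr => H HF.
have flatH : flat H r by move: HF; rewrite inE => /andP[_ /asboolP].
rewrite -(big_imset f (assemble_inj flatH)) /=; apply: eq_bigl => K.
apply/andP/idP => [[KA /eqP <-]|KF]; first by have [] := hP K KA.
split; last by apply/eqP/h_uniq.
by case/imsetP: KF => p pF ->; apply: fibre_A.
Qed.

(** All graphs of [A] share a vertex set, so one root serves them all; within a fibre the number of
    blocks is constant, namely the number of labels. *)
Lemma sum_wide m :
  \sum_(K in A) (`[< wide (2 * m).+4 K >])%:R <= \sum_(K in A) wide_weight m #|blocks K|.
Proof.
have [W1|W1] := leqP #|W| 1.
  apply: ler_sum => K /A_graph[conK KW].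
  rewrite (_ : `[< _ >] = false) ?wide_weight_ge0 //; apply/asboolPn/not_wide_small => //.
  by rewrite KW.
have /card_gt0P[r rW] : (0 < #|W|)%N by apply: ltnW.
rewrite !(sum_fibres _ rW); apply: ler_sum => H; rewrite inE => /andP[HA /asboolP flatH].
have V1 : (1 < #|vset H|)%N by have [_ ->] := A_graph HA.
rewrite [leRHS](eq_bigr (fun=> wide_weight m #|labels H r|)); last first.
  by move=> p pF; rewrite /= card_hang_blocks //; exact: fibre_pointer.
have -> : \sum_(p in fibre H r) (`[< wide (2 * m).+4 (assemble H r p) >])%:R =
    #|[set p in fibre H r | `[< wide (2 * m).+4 (assemble H r p) >]]|%:R :> R.
  rewrite -natr_sum; congr _%:R; rewrite -sum1_card [RHS]big_mkcond /=.
  rewrite [LHS]big_mkcond; apply: eq_bigr => p _; rewrite in_sep.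
  by case: (p \in _) => //=; case: asbool.
have D0 : (0 < #|labels H r|)%N.
  case/card_gt1P: V1 => v [w [vV wV vw]]; have [vr|vr] := eqVneq v r.
    by apply/card_gt0P; exists (body_label H r w); apply: imset_f; rewrite in_setD1 wV -vr eq_sym vw.
  by apply/card_gt0P; exists (body_label H r v); apply: imset_f; rewrite in_setD1 vV vr.
rewrite sumr_const -[leRHS]mulr_natl /wide_weight mulrA ler_pdivlMr ?ltr0n ?expn_gt0 ?D0 //.
rewrite -!natrM ler_nat; apply: leq_trans (card_fibre_wide flatH m V1) _; lia.
Qed.
End ConnectedClass.

(** * Replacing one component of a graph *)

Section Joins.
Variable T : finType.
Implicit Types (K H G C F : graph T) (W : {set T}) (x y : T).

(** The vertices of a component [C] stay as isolated vertices, so that [join] can put another graph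
    on them. *)
Definition remainder G C : graph T := mkgraph (vset G) (eset G :\: eset C).

Definition join F K : graph T := mkgraph (vset F) (eset F :|: eset K).

Lemma adj_join F K x y : vset K \subset vset F -> adj (join F K) x y = adj F x y || adj K x y.
Proof.
move=> sKF; rewrite adj_mkgraph in_setU -/(adj F x y) -/(adj K x y).
apply/and4P/orP => [[_ _ _ /orP//]|a].
have [xy xF yF] : [/\ x != y, x \in vset F & y \in vset F].
  case: a => a; first by rewrite (adj_neq a) (adj_vsetl a) (adj_vsetr a).
  by rewrite (adj_neq a) !(subsetP sKF) ?(adj_vsetl a) ?(adj_vsetr a).
by split=> //; apply/orP.
Qed.

Lemma adj_remainder G C x y : adj (remainder G C) x y = adj G x y && ~~ adj C x y.
Proof.
rewrite adj_mkgraph in_setD -/(adj G x y) -/(adj C x y) [_ && adj G x y]andbC.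
case: (boolP (adj G x y)) => [a|_]; last by rewrite !andbF.
by rewrite (adj_neq a) (adj_vsetl a) (adj_vsetr a).
Qed.

Lemma join_remainder G C : subgraph C G -> join (remainder G C) C = G.
Proof.
move=> /subgraphP[sV sE]; apply: graph_eqP => // x y; rewrite adj_join // adj_remainder.
by apply/orP/idP => [[/andP[]//|/sE//]|->]; case: (adj C x y); [right|left].
Qed.

Lemma remainder_avoid G C x y : C \in components G -> adj (remainder G C) x y -> x \notin vset C.
Proof.
move=> CG; rewrite adj_remainder => /andP[a]; apply: contra => xC.
exact: component_closed CG xC a.
Qed.

Definition avoiding F W : Prop := W \subset vset F /\ forall x y, adj F x y -> x \notin W.

Lemma remainder_join F K : avoiding F (vset K) -> remainder (join F K) K = F.
Proof.
move=> [sKF av]; apply: graph_eqP => // x y; rewrite adj_remainder adj_join //.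
case: (boolP (adj F x y)) => [a|_] /=; last by rewrite andbN.
by apply: contra (av x y a) => /adj_vsetl.
Qed.

Lemma components_join F K : avoiding F (vset K) -> connected_graph K ->
  components (join F K) = K |: [set comp_of F x | x in vset F :\: vset K].
Proof.
move=> [sKF av] conK; have aJ x y := adj_join x y sKF.
have av' x y : adj F x y -> y \notin vset K by rewrite adj_sym; apply: av.
have inK x y : x \in vset K -> adj (join F K) x y = adj K x y.
  by move=> xK; rewrite aJ; case: (boolP (adj F x y)) => // /av; rewrite xK.
have notK x y : x \notin vset K -> adj (join F K) x y = adj F x y.
  move=> xK; rewrite aJ; case: (boolP (adj K x y)); rewrite ?orbF // => /adj_vsetl.
  by rewrite (negPf xK).
have compK x : x \in vset K -> comp_of (join F K) x = K.
  move=> xK; apply: subgraph_anti; last first.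
    apply: connected_sub_comp => //; apply/subgraphP; split=> // u v a.
    by rewrite aJ a orbT.
  have sub : {subset compset (join F K) x <= vset K}.
    move=> y; rewrite inE => xy.
    refine (@connect_stable _ _ (mem (vset K)) x y _ xy xK) => u v a uK.
    by move: a; rewrite inK // => /adj_vsetr.
  apply/subgraphP; split; first exact/subsetP.
  by move=> u v; rewrite adj_induced => /and3P[/sub uK _]; rewrite inK.
have compN x : x \notin vset K -> comp_of (join F K) x = comp_of F x.
  move=> xK; have stab y : connect (adj (join F K)) x y -> connect (adj F) x y && (y \notin vset K).
    move=> xy; pose P w := connect (adj F) x w && (w \notin vset K).
    refine (@connect_stable _ _ P x y _ xy _); last by rewrite /P connect0.
    move=> u v a /andP[xu uK]; move: a; rewrite notK // => a.
    by rewrite /P (av' _ _ a) andbT (connect_trans xu) // connect1.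
  have E : compset (join F K) x = compset F x.
    apply/setP => y; rewrite !inE; apply/idP/idP => [/stab/andP[]//|].
    by apply: connect_mono => u v a; rewrite aJ a.
  apply: graph_eqP => // u v; rewrite !adj_induced E.
  case: (boolP (u \in compset F x)) => //= uF; case: (v \in _) => //=.
  by rewrite notK //; move: uF; rewrite -E inE => /stab/andP[].
rewrite componentsE; apply/setP => C; rewrite in_setU1; apply/imsetP/predU1P.
  move=> [x xF ->]; have [xK|xK] := boolP (x \in vset K); first by left; apply: compK.
  by right; rewrite compN //; apply: imset_f; rewrite in_setD xK.
move=> [->|/imsetP[x /setDP[xF xK] ->]]; last by exists x; rewrite ?compN.
have /connected_graphP[/set0Pn[x xK] _] := conK.
by exists x; rewrite ?compK // (subsetP sKF).
Qed.

Lemma sim_of G H (f : graph T -> graph T) : {in components G &, injective f} ->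
  f @: components G = components H ->
  {in components G, forall C, sim_connected C (f C)} -> sim G H.
Proof.
move=> finj fE fsim; exists #|components G|, (fun i => enum_val i), (fun i => f (enum_val i)).
split.
- exact: enum_val_inj.
- apply/setP => C; apply/imsetP/idP => [[i _ ->]|CG]; first exact: enum_valP.
  by exists (enum_rank_in CG C) => //; rewrite enum_rankK_in.
- by move=> i j /(finj _ _ (enum_valP _) (enum_valP _)) /enum_val_inj.
- rewrite -fE; apply/setP => C; apply/imsetP/imsetP => [[i _ ->]|[D DG ->]].
    by exists (enum_val i); rewrite // enum_valP.
  by exists (enum_rank_in DG D) => //; rewrite enum_rankK_in.
- by move=> i; apply/fsim/enum_valP.
Qed.

(** The bijection exchanges [K'] for [K] and fixes every other component. *)
Lemma sim_join F K K' : avoiding F (vset K) -> connected_graph K -> connected_graph K' ->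
  sim_connected K' K -> sim (join F K') (join F K).
Proof.
move=> avK conK conK' simK; have VE : vset K' = vset K by case: simK.
have avK' : avoiding F (vset K') by rewrite VE.
set S := [set comp_of F x | x in vset F :\: vset K].
have CE : components (join F K) = K |: S by apply: components_join.
have CE' : components (join F K') = K' |: S by rewrite components_join // VE.
have notS X : connected_graph X -> vset X = vset K -> X \notin S.
  move=> /connected_graphP[_ _] XE; apply/imsetP => -[x /setDP[_ xK] E].
  by case/negP: xK; rewrite -XE E compset_id.
have KS := notS K conK erefl; have K'S := notS K' conK' VE.
apply: (@sim_of _ _ (fun C => if C == K' then K else C)); rewrite ?CE CE'.
- move=> C D /setU1P[->|CS] /setU1P[->|DS] //; rewrite ?eqxx.
  + by case: eqP => // _ KD; rewrite -KD (negPf KS) in DS.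
  + by case: eqP => // _ KC; rewrite KC (negPf KS) in CS.
  + have [CK|_] := eqVneq C K'; first by rewrite -CK CS in K'S.
    by have [DK|//] := eqVneq D K'; rewrite -DK DS in K'S.
- apply/setP => C; apply/imsetP/setU1P => [[D /setU1P[->|DS] ->]|[->|CS]].
  + by rewrite eqxx; left.
  + by case: eqP => _; [left|right].
  + by exists K'; rewrite ?setU11 ?eqxx.
  + exists C; rewrite ?in_setU1 ?CS ?orbT //.
    by case: eqP => // CK; rewrite -CK CS in K'S.
- move=> C /setU1P[->|CS]; first by rewrite eqxx.
  by case: eqP => [CK|_]; [rewrite -CK CS in K'S|apply: sim_connected_refl].
Qed.
End Joins.

(** * Blocks and block forest of a disconnected graph *)

Section BlockCounts.
Variable T : finType.
Implicit Types (G C B : graph T).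

Lemma block_nonempty G B : B \in blocks G -> exists2 v, v \in vset B & v \in vset G.
Proof.
rewrite blocksE => /maximal_subgraphP[sBG /nonseparableP[/connected_graphP[/set0Pn[v vB] _] _] _].
by exists v; rewrite // (subsetP (subgraph_vset sBG)).
Qed.

Lemma block_vset_sub G B : B \in blocks G -> vset B \subset vset G.
Proof. by rewrite blocksE => /maximal_subgraphP[/subgraph_vset]. Qed.

Lemma blocks_component G C B : C \in components G -> B \in blocks C -> B \in blocks G.
Proof.
move=> CG BC; have [v vB vC] := block_nonempty BC; move: BC; rewrite !blocksE.
move=> /maximal_subgraphP[sBC nsB maxB]; have sCG := component_sub CG.
apply/maximal_subgraphP; split=> //; first exact: subgraph_trans sCG.
move=> K sKG nsK sBK; apply: maxB => //.
rewrite (component_comp_of CG vC); apply: connected_sub_comp => //.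
  by case/nonseparableP: nsK.
exact: (subsetP (subgraph_vset sBK)).
Qed.

Lemma component_disjoint G C D v : C \in components G -> D \in components G ->
  v \in vset C -> v \in vset D -> C = D.
Proof. by move=> CG DG vC vD; rewrite (component_comp_of CG vC) (component_comp_of DG vD). Qed.

(** A block of a component is a block of [G], and components are disjoint, so no block is counted
    twice. *)
Lemma sum_blocks_components G : (\sum_(C in components G) #|blocks C| <= #|blocks G|)%N.
Proof.
pose own B := odflt G [pick C in components G | B \in blocks C].
rewrite (eq_bigr (fun C => \sum_(B in blocks C) 1)%N); last by move=> C _; rewrite sum1_card.
rewrite (eq_bigr (fun C => \sum_(B | (B \in blocks C) && (own B == C)) 1)%N); last first.
  move=> C CG; apply: eq_bigl => B; case: (boolP (B \in blocks C)) => //= BC.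
  rewrite /own; case: pickP => [D /andP[DG BD]|/(_ C)]; last by rewrite CG BC.
  have [v vB vC] := block_nonempty BC; apply/esym/eqP/(component_disjoint DG CG _ vC).
  exact: (subsetP (block_vset_sub BD)).
rewrite (exchange_big_dep (mem (blocks G))) /=; last first.
  by move=> C B CG /andP[BC _]; apply: blocks_component BC.
rewrite -sum1_card; apply: leq_sum => B _.
rewrite sum1_card; apply/card_le1_eqP => C D.
by rewrite !unfold_in => /and3P[_ _ /eqP <-] /and3P[_ _ /eqP].
Qed.

(** Blocks correspond to the bodies of a flat graph, whose representatives are vertices other than
    the root; a single vertex is treated apart. *)
Lemma card_blocks_connected C : connected_graph C -> (#|blocks C| <= #|vset C|)%N.
Proof.
move=> conC; have /connected_graphP[/set0Pn[r rC] _] := conC.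
have [C1|C1] := leqP #|vset C| 1.
  apply: (@leq_trans 1); last by rewrite card_gt0; apply/set0Pn; exists r.
  have vE v : v \in vset C -> v = r by move=> vC; apply: (card_le1_eqP C1).
  have BE B : B \in blocks C -> vset B = [set r] /\ forall x y, adj B x y = false.
    move=> BC; have sub := subsetP (block_vset_sub BC).
    have [v vB vC] := block_nonempty BC; split.
      by apply/setP => w; rewrite inE; apply/idP/eqP => [/sub/vE//|->]; rewrite -(vE v vC).
    move=> x y; apply/negP => a; move: (adj_neq a).
    by rewrite (vE x (sub x (adj_vsetl a))) (vE y (sub y (adj_vsetr a))) eqxx.
  apply/card_le1_eqP => B B' BC B'C; have [V1 a1] := BE B BC; have [V2 a2] := BE B' B'C.
  by apply: graph_eqP => [|x y]; rewrite ?V1 ?V2 ?a1 ?a2.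
have [H [par [flatH parH hE]]] := exists_flat conC rC.
have VE : vset H = vset C by rewrite -hE.
rewrite -hE card_hang_blocks // ?VE //; apply: leq_trans (leq_imset_card _ _) _.
exact/subset_leq_card/subD1set.
Qed.

Lemma sum_vset_components G : (\sum_(C in components G) #|vset C| <= #|vset G|)%N.
Proof.
rewrite (eq_bigr (fun C => \sum_(v in vset C) 1)%N); last by move=> C _; rewrite sum1_card.
rewrite (exchange_big_dep (mem (vset G))) /=; last first.
  by move=> C v CG vC; apply: (subsetP (subgraph_vset (component_sub CG))).
rewrite -sum1_card; apply: leq_sum => v _.
rewrite sum1_card; apply/card_le1_eqP => C D.
by move=> /andP[CG vC] /andP[DG vD]; apply: (component_disjoint DG CG vD vC).
Qed.
End BlockCounts.

Section BlockForest.
Variable T : finType.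
Implicit Types (G C D B : graph T).

Lemma block_tree_disjoint G C D x : C \in components G -> D \in components G ->
  x \in vset (block_tree C) -> x \in vset (block_tree D) -> C = D.
Proof.
case: x => [v|B] CG DG; first by rewrite !in_block_tree_l; apply: (component_disjoint CG DG).
rewrite !in_block_tree_r => BC BD; have [v vB vC] := block_nonempty BC.
by apply: (component_disjoint CG DG vC); apply: (subsetP (block_vset_sub BD)).
Qed.

(** Edges of the forest stay inside one block tree, so a distant pair lies in the tree of a single
    component. *)
Lemma diam_block_forest G m : (m < diam (block_forest G))%N ->
  exists2 C, C \in components G & wide m C.
Proof.
rewrite ltnNge => /negP nle; apply: contrapT => none; apply: nle.
have adjP C x y : C \in components G -> x \in vset (block_tree C) ->
    adj (block_forest G) x y -> adj (block_tree C) x y.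
  move=> CG xC; rewrite adj_mkgraph => /and4P[_ _ _ /bigcupP[D DG a]].
  by rewrite (block_tree_disjoint CG DG xC (adj_vsetl a)).
apply: diam_le => X XG x y xX yX.
have sXG := component_sub XG.
have /bigcupP[C CG xC] : x \in vset (block_forest G) by apply: (subsetP (subgraph_vset sXG)).
have /connected_graphP[_ /(_ x y xX yX)/(connect_subgraph sXG) xy] := component_is_connected XG.
have yC : y \in vset (block_tree C).
  refine (@connect_stable _ _ (mem (vset (block_tree C))) x y _ xy xC) => u v a uC.
  exact: adj_vsetr (adjP C u v CG uC a).
suff : walk_le (block_tree C) m x y.
  apply: walk_le_mono => u v a; rewrite adj_mkgraph (adj_neq a) /=.
  apply/and3P; split; apply/bigcupP; exists C => //; first exact: adj_vsetl a.
  exact: adj_vsetr a.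
by apply: contrapT => nw; apply: none; exists C => //; exists x, y.
Qed.
End BlockForest.

(** * Summation over all pairs of a graph and a component *)

Section GraphClass.
Variables (R : realFieldType) (T : finType) (A : {set graph T}).
Implicit Types (K G C F : graph T).
Hypothesis A_sim : forall G G', G \in A -> vset G' = vset G -> sim G' G -> G' \in A.

(** [W] is recorded because [F] does not determine it: isolated vertices of [F] may be components of
    their own. *)
Let part F (W : {set T}) : {set graph T} :=
  [set K | [&& join F K \in A, K \in components (join F K), remainder (join F K) K == F &
               vset K == W]].

Let sum_parts (f : graph T -> R) :
  \sum_(G in A) \sum_(C in components G) f C =
  \sum_(FW : graph T * {set T}) \sum_(K in part FW.1 FW.2) f K.
Proof.
rewrite pair_big_dep /=.
rewrite (partition_big (fun q : graph T * graph T => (remainder q.1 q.2, vset q.2)) predT) //=.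
apply: eq_bigr => -[F W] _ /=.
rewrite (reindex_onto (fun K => (join F K, K)) snd) /=; last first.
  move=> [G C] /andP[/andP[_ CG] /eqP[/= <- _]].
  by rewrite join_remainder // component_sub.
by apply: eq_bigl => K; rewrite [RHS]in_set xpair_eqE eqxx andbT -!andbA.
Qed.

Lemma sum_components_wide m :
  \sum_(G in A) \sum_(C in components G) (`[< wide (2 * m).+4 C >])%:R <=
  \sum_(G in A) \sum_(C in components G) wide_weight R m #|blocks C|.
Proof.
rewrite !sum_parts; apply: ler_sum => -[F W] _ /=; apply: (@sum_wide _ _ _ W).
  by move=> K; rewrite in_set => /and4P[_ KG _ /eqP ->]; rewrite (component_is_connected KG).
move=> K K'; rewrite in_set => /and4P[JA KG /eqP FE /eqP WE] conK' simK.
have VE : vset K' = vset K by case: simK.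
have avK : avoiding F (vset K).
  split; first by apply: (subgraph_vset (component_sub KG)).
  by move=> x y; rewrite -{1}FE; apply: remainder_avoid.
have avK' : avoiding F (vset K') by rewrite VE.
rewrite in_set remainder_join // components_join // setU11 VE WE !eqxx !andbT /=.
apply: (A_sim JA) => //; apply: sim_join => //; exact: component_is_connected KG.
Qed.

Lemma card_diam_block_forest m :
  #|[set G in A | ((2 * m).+4 < diam (block_forest G))%N]|%:R <=
  \sum_(G in A) \sum_(C in components G) wide_weight R m #|blocks C|.
Proof.
apply: le_trans (sum_components_wide m).
rewrite -sum1_card natr_sum big_mkcond [leRHS]big_mkcond /=.
apply: ler_sum => G _; rewrite in_sep; case: (G \in A) => //=.
case: ifP => [/diam_block_forest[C CG wC]|_]; last by apply: sumr_ge0.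
rewrite (bigD1 C) //= (introT (asboolP _) wC) lerDl; exact: sumr_ge0.
Qed.
End GraphClass.

(** * Tail bounds and limits *)

From mathcomp Require Import ring lra.
From mathcomp Require Import all_classical all_reals all_analysis.

Import Order.TTheory GRing.Theory Num.Theory.
Import numFieldNormedType.Exports.
Local Open Scope classical_set_scope.
Local Open Scope ring_scope.

Section Tails.
Variable R : realType.
Implicit Types (x t kappa : R) (m n k : nat).

Definition tail_bound m kappa : R :=
  m.+2%:R * kappa ^+ 2 * expR (- (m%:R * (m%:R - 1) / (2 * kappa))).

(** Each new factor is at most [1 - m / k <= exp (- m / kappa)], or zero by truncation once
    [k < m]. *)
Lemma ffact_ratio_le m k kappa : (0 < k)%N -> k%:R <= kappa ->
  (k ^_ m)%:R / (k ^ m)%:R <= expR (- (m%:R * (m%:R - 1) / (2 * kappa))).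
Proof.
move=> k0 kk; have kap0 : 0 < kappa by apply: lt_le_trans kk; rewrite ltr0n.
have k0' : 0 < k%:R :> R by rewrite ltr0n.
elim: m => [|m IH]; first by rewrite ffactn0 expn0 divr1 mul0r mul0r oppr0 expR0.
rewrite ffactnSr expnSr !natrM invfM mulrACA [X in _ <= expR X](_ : _ =
   - (m%:R * (m%:R - 1) / (2 * kappa)) + - (m%:R / kappa)); last first.
  by rewrite -natr1; field; rewrite gt_eqF.
rewrite expRD; apply: ler_pM => //; try by rewrite divr_ge0.
have [mk|km] := leqP m k; last first.
  by rewrite (eqP (ltnW km)) mul0r expR_ge0.
rewrite natrB // mulrBl divff ?gt_eqF //.
apply: le_trans (expR_ge1Dx _); rewrite lerD2l lerN2.
by rewrite ler_wpM2l // lef_pV2 // posrE.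
Qed.

Lemma wide_weight_le m k kappa : k%:R <= kappa ->
  wide_weight R m k <= m.+2%:R * k%:R ^+ 2 * expR (- (m%:R * (m%:R - 1) / (2 * kappa))).
Proof.
have [->|k0] := posnP k.
  by move=> _; rewrite /wide_weight exp0n // muln0 mul0n mul0r expr0n /= mulr0 mul0r.
move=> kk; rewrite /wide_weight -natrX 2!natrM -mulrA.
by apply: ler_wpM2l; [rewrite mulr_ge0|apply: ffact_ratio_le].
Qed.

(** The squares of the block numbers sum to at most the square of their sum, so splitting into
    components costs nothing. *)
Lemma sum_wide_weight_le (I : finType) (S : {set I}) (f : I -> nat) m kappa :
  (\sum_(i in S) f i)%:R <= kappa ->
  \sum_(i in S) wide_weight R m (f i) <= tail_bound m kappa.
Proof.
move=> le_k; set e := expR (- (m%:R * (m%:R - 1) / (2 * kappa))).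
apply: (@le_trans _ _ (\sum_(i in S) m.+2%:R * (f i)%:R ^+ 2 * e)).
  apply: ler_sum => i iS; apply: wide_weight_le; apply: le_trans le_k.
  by rewrite ler_nat (bigD1 i) //= leq_addr.
rewrite -mulr_suml -mulr_sumr /tail_bound -/e.
apply: ler_wpM2r; first exact: expR_ge0.
apply: ler_wpM2l => //.
have sum_sq : \sum_(i in S) (f i)%:R ^+ 2 <= (\sum_(i in S) f i)%:R ^+ 2 :> R.
  rewrite natr_sum [leRHS]expr2 mulr_suml; apply: ler_sum => i iS.
  rewrite expr2; apply: ler_wpM2l => //.
  by rewrite (bigD1 i) //= lerDl sumr_ge0.
by apply: le_trans sum_sq _; rewrite lerXn2r // nnegrE // (le_trans _ le_k).
Qed.

Lemma class_pr_wide (A : graph_class) n m kappa (P : graph 'I_n -> Prop) :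
  weakly_block_stable A -> 0 <= kappa ->
  (forall G, G \in graphs_on A n -> (\sum_(C in components G) #|blocks C|)%:R <= kappa) ->
  (forall G, P G -> ((2 * m).+4 < diam (block_forest G))%N) ->
  class_pr R A P <= tail_bound m kappa.
Proof.
move=> stA k0 le_k Pm; rewrite /class_pr /unif_pr.
have tb0 : 0 <= tail_bound m kappa.
  by rewrite !mulr_ge0 ?expR_ge0 ?exprn_ge0.
have [->|An0] := eqVneq (graphs_on A n) finset.set0.
  by rewrite cards0 invr0 mulr0.
rewrite ler_pdivrMr; last by rewrite ltr0n card_gt0.
have A_sim G G' : G \in graphs_on A n -> vset G' = vset G -> sim G' G -> G' \in graphs_on A n.
  rewrite !inE => /andP[/eqP VG /asboolP AG] -> simG; rewrite VG eqxx /=.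
  by apply/asboolP/(stA _ G).
have := @card_diam_block_forest R _ _ A_sim m.
move=> /(fun h => le_trans _ h) H; apply: le_trans (H _ _) _.
  rewrite ler_nat; apply: subset_leq_card; apply/fintype.subsetP => G; rewrite !in_sep.
  by move=> /andP[-> /asboolP /Pm].
rewrite mulrC mulr_natl -sumr_const; apply: ler_sum => G GA.
exact/sum_wide_weight_le/le_k.
Qed.

(** [m (m - 1) >= (t - c) (t - c - 1) >= t ^ 2 - (2 c + 1) t], where [1 + c <= t] keeps the factors
    nonnegative. *)
Lemma tail_bound_le m kappa t (c : R) : 0 < kappa -> 1 + c <= t -> 0 <= c -> t - c <= m%:R -> m%:R <= t - 2 ->
  tail_bound m kappa <= t * kappa ^+ 2 * expR (- ((t ^+ 2 - (2 * c + 1) * t) / (2 * kappa))).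
Proof.
move=> k0 tc c0 mt tm; rewrite /tail_bound; apply: ler_pM; rewrite ?expR_ge0 //.
- by rewrite mulr_ge0 // exprn_ge0 // ltW.
- apply: ler_wpM2r; first by rewrite exprn_ge0 // ltW.
  by rewrite -natr1 -natr1; lra.
rewrite ler_expR lerN2 ler_wpM2r // ?invr_ge0 ?mulr_ge0 // ?ltW //.
nra.
Qed.

Lemma tail_log kappa : 9 <= kappa -> expR 1 <= kappa ->
  exists m, (2 * m).+4%:R <= 5 * Num.sqrt (kappa * ln kappa) /\
    tail_bound m kappa <= 5 / 2 * expR (35 / 4) * expR (- (ln kappa / 8)).
Proof.
move=> k9 ke; have k0 : 0 < kappa by lra.
have ln1 : 1 <= ln kappa by rewrite -(expRK 1) ler_ln // posrE expR_gt0.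
have lnk : ln kappa <= kappa.
  by rewrite -{2}(lnK (x := kappa)) ?posrE //; have := expR_ge1Dx (ln kappa); lra.
pose s := Num.sqrt (kappa * ln kappa).
have s2 : s ^+ 2 = kappa * ln kappa by rewrite sqr_sqrtr // mulr_ge0; lra.
have s0 : 0 <= s by apply: sqrtr_ge0.
have s3 : 3 <= s.
  rewrite -(@ler_pXn2r _ 2) ?nnegrE // s2 (_ : 3 ^+ 2 = 9 * 1); last by ring.
  by apply: ler_pM; lra.
have sk : s <= kappa.
  by rewrite -(@ler_pXn2r _ 2) ?nnegrE ?s2 ?(ltW k0) // expr2 ler_wpM2l // ltW.
(* [m + 2 <= t] gives [2 m + 4 <= 5 s]; rounding down loses at most one, hence [c = 3] below. *)
pose t := 5 / 2 * s; pose m := Num.truncn (t - 2).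
have /andP[m1 m2] : m%:R <= t - 2 < m.+1%:R by apply: truncn_itv; rewrite /t; lra.
rewrite -(natr1 m) in m2; exists m; split.
  rewrite -[(2 * m).+4]/(4 + 2 * m)%N natrD natrM -/s; move: m1; rewrite /t; lra.
apply: le_trans (tail_bound_le (c := 3) k0 _ _ _ m1) _; [by rewrite /t; lra|by []|lra|].
rewrite /t.
suff : s * kappa ^+ 2 * expR (- (((5 / 2 * s) ^+ 2 - (2 * 3 + 1) * (5 / 2 * s)) / (2 * kappa))) <=
    expR (35 / 4) * expR (- (ln kappa / 8)) by lra.
apply: (@le_trans _ _ (expR (3 * ln kappa) * expR (- (((5 / 2 * s) ^+ 2 - (2 * 3 + 1) * (5 / 2 * s)) / (2 * kappa))))).
  apply: ler_wpM2r; first exact: expR_ge0.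
  have -> : expR (3 * ln kappa) = kappa ^+ 3 by rewrite expRM_natl lnK ?posrE.
  by rewrite [leRHS]exprS ler_wpM2r // exprn_ge0 // ltW.
rewrite -!expRD ler_expR.
(* The main term exceeds the [3 ln kappa] of the prefactor by [ln kappa / 8]; the rounding term is
   at most [35 / 4] because [s <= kappa]. *)
have -> : ((5 / 2 * s) ^+ 2 - (2 * 3 + 1) * (5 / 2 * s)) / (2 * kappa) =
    25 / 8 * ln kappa - 35 / 4 * (s / kappa).
  by rewrite exprMn s2; field; rewrite gt_eqF.
have : s / kappa <= 1 by rewrite ler_pdivrMr // mul1r.
lra.
Qed.
End Tails.

(** * Passage to the limit and the linear scale *)

Section Limits.
Variable R : realType.

Lemma sum_blocks_le_order n (G : graph 'I_n) : (\sum_(C in components G) #|blocks C| <= n)%N.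
Proof.
apply: (@leq_trans (\sum_(C in components G) #|vset C|)).
  by apply: leq_sum => C /component_is_connected; apply: card_blocks_connected.
apply: leq_trans (sum_vset_components G) _.
by rewrite -[X in (_ <= X)%N](card_ord n) max_card.
Qed.

Lemma class_infty_filter A : Filter (class_infty A).
Proof. exact: within_filter. Qed.
#[local] Existing Instance class_infty_filter.

Lemma cvg_expR_ln A (k : nat -> R) (c : R) : k @ class_infty A --> +oo ->
  (fun n => c * expR (- (ln (k n) / 8))) @ class_infty A --> (0 : R).
Proof.
move=> /cvgryPge kinf; rewrite -[X in _ --> X](mulr0 c).
apply: cvgM; first exact: cvg_cst.
apply: (cvg_comp (fun n => ln (k n) / 8) (fun x => expR (- x))); last exact: cvgr_expR.
apply/cvgryPge => M; apply: filterS (kinf (expR (8 * M))) => n le_k.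
have k0 : 0 < k n by apply: lt_le_trans le_k; apply: expR_gt0.
by rewrite ler_pdivlMr // mulrC -[leLHS]expRK ler_ln ?posrE ?expR_gt0.
Qed.

Lemma class_prC A n (P Q : graph 'I_n -> Prop) : graphs_on A n != finset.set0 ->
  (forall G, P G <-> ~ Q G) -> class_pr R A P = 1 - class_pr R A Q.
Proof.
rewrite /class_pr /unif_pr; move: (graphs_on A n) => S S0 PQ.
have c0 : #|S|%:R != 0 :> R by rewrite pnatr_eq0 cards_eq0.
apply: (mulIf c0); rewrite mulrBl mul1r !divfK //; apply/eqP.
rewrite eq_sym subr_eq -natrD eqr_nat -(cardsID (finset (fun G => `[< P G >])) S).
apply/eqP; congr (_ + _)%N; apply: eq_card => G.
  by rewrite finset.in_setI finset.in_set in_sep.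
rewrite finset.in_setD finset.in_set in_sep andbC; congr (_ && _).
rewrite -asbool_neg; apply: asbool_equiv_eq; split => [nP|q /PQ//].
by apply: contrapT => nQ; apply/nP/PQ.
Qed.

Lemma whp_diam A (k : nat -> R) : weakly_block_stable A ->
  (forall n (G : graph 'I_n), G \in graphs_on A n ->
     (\sum_(C in components G) #|blocks C|)%:R <= k n) ->
  k @ class_infty A --> +oo ->
  whp R A (fun n G => (diam (block_forest G))%:R <= 5 * Num.sqrt (k n * ln (k n)) :> R).
Proof.
move=> stA le_k kinf; rewrite /whp.
have lim0 := cvg_expR_ln (5 / 2 * expR (35 / 4)) kinf.
have lim1 : (fun n => 1 - 5 / 2 * expR (35 / 4) * expR (- (ln (k n) / 8))) @ class_infty A --> (1 : R).
  by rewrite -[X in _ --> X]subr0; apply: cvgB => //; apply: cvg_cst.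
apply: (squeeze_cvgr _ lim1 (cvg_cst (1 : R))).
move/cvgryPge in kinf.
have nonempty : \forall n \near class_infty A, graphs_on A n != finset.set0.
  by apply: withinT.
apply: filterS3 (kinf 9) (kinf (expR 1)) nonempty => n k9 ke A0.
have [m [le_m tb]] := tail_log k9 ke.
rewrite (@class_prC A n _ (fun G => ~ (diam (block_forest G))%:R <= 5 * Num.sqrt (k n * ln (k n)) :> R)) //; last first.
  by move=> G; split => [p []|/contrapT].
apply/andP; split.
  rewrite lerD2l lerN2; apply: le_trans tb; apply: class_pr_wide => //; first by lra.
    by move=> G /le_k.
  by move=> G /negP; rewrite -ltNge -(ltr_nat R); apply: le_lt_trans.
by rewrite gerBl /class_pr /unif_pr divr_ge0.
Qed.
(** The exponent is about [eps ^ 2 n / 8]; one half of it absorbs the polynomial prefactor, the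
    other half is the rate. *)
Lemma tail_linear (eps : R) : 0 < eps -> exists n0 : nat, forall n, (n0 <= n)%N ->
  exists m, (2 * m).+4%:R < eps * n%:R /\
    tail_bound m n%:R <= expR (- (eps ^+ 2 / 16 * n%:R)).
Proof.
move=> e0; pose c := eps ^+ 2 / 16; have c0 : 0 < c by rewrite divr_gt0 ?exprn_gt0.
pose C := eps / 2 * expR (9 / 4 * eps).
have C0 : 0 < C by rewrite mulr_gt0 ?expR_gt0 // divr_gt0.
(* The first term ensures [eps n >= 12], so [t >= 6]; the second bounds the prefactor [C n ^ 3] by
   [(c n / 4) ^ 4]. *)
pose M := 12 / eps + C / (c / 4) ^+ 4; exists (Num.truncn M).+1 => n le_n.
have lt_M : M < n%:R by apply: lt_le_trans (truncnS_gt M) _; rewrite ler_nat.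
have c4 : 0 < (c / 4) ^+ 4 by apply/exprn_gt0/divr_gt0.
have q0 : 0 < C / (c / 4) ^+ 4 by apply: divr_gt0.
have p0 : 0 < 12 / eps by rewrite divr_gt0.
have n0 : 0 < n%:R :> R by rewrite /M in lt_M; lra.
have en : 12 <= eps * n%:R.
  by rewrite mulrC -ler_pdivrMr //; rewrite /M in lt_M; lra.
have Cn : C <= (c / 4) ^+ 4 * n%:R.
  by rewrite mulrC -ler_pdivrMr //; rewrite /M in lt_M; lra.
have [t tE] : exists t, t = eps / 2 * n%:R by exists (eps / 2 * n%:R).
(* Subtracting [3] rather than [2] makes [2 m + 4 < eps n] strict, as the event includes
   equality. *)
pose m := Num.truncn (t - 3).
have /andP[m1 m2] : m%:R <= t - 3 < m.+1%:R by apply: truncn_itv; rewrite tE; lra.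
rewrite -(natr1 m) in m2; exists m; split.
  by rewrite -[(2 * m).+4]/(4 + 2 * m)%N natrD natrM; rewrite tE in m1; lra.
apply: le_trans (tail_bound_le (m := m) (t := t) (c := 4) n0 _ _ _ _) _; [by rewrite tE; lra|by []|lra|lra|].
have -> : - ((t ^+ 2 - (2 * 4 + 1) * t) / (2 * n%:R)) =
    9 / 4 * eps + (- (c * n%:R) - c * n%:R).
  by rewrite tE /c; field; rewrite gt_eqF.
have main : t * n%:R ^+ 2 * expR (9 / 4 * eps) <= expR (c * n%:R).
  apply: (@le_trans _ _ ((c / 4 * n%:R) ^+ 4)).
    have -> : t * n%:R ^+ 2 * expR (9 / 4 * eps) = C * n%:R ^+ 3 by rewrite tE /C; ring.
    rewrite exprMn [n%:R ^+ 4]exprS mulrA; apply: ler_wpM2r => //.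
  (* [exp (c n)] is the fourth power of [exp (c n / 4)], which is at least [c n / 4]. *)
  have -> : c * n%:R = 4%:R * (c / 4 * n%:R) by field.
  rewrite expRM_natl lerXn2r // ?nnegrE ?expR_ge0 //.
    by rewrite mulr_ge0 // ltW // divr_gt0.
  by have := expR_ge1Dx (c / 4 * n%:R); lra.
rewrite -/c expRD mulrA.
apply: (@le_trans _ _ (expR (c * n%:R) * expR (- (c * n%:R) - c * n%:R))).
  by apply: ler_wpM2r; rewrite ?expR_ge0.
by rewrite -expRD ler_expR; lra.
Qed.
End Limits.

Theorem theorem1p2 (R : realType) :
  (forall A : graph_class, weakly_block_stable A ->
     whp R A (fun n G =>
       (diam (block_forest G))%:R <= 5 * Num.sqrt (n%:R * ln n%:R) :> R))
  /\
  (forall eps : R, 0 < eps ->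
     exists (delta : R) (n0 : nat), 0 < delta /\
       forall A : graph_class, weakly_block_stable A ->
       forall n : nat, (n0 <= n)%N -> graphs_on A n != finset.set0 ->
         class_pr R A (fun G : graph 'I_n =>
           eps * n%:R <= (diam (block_forest G))%:R)
         <= expR (- (delta * n%:R)))
  /\
  (forall (A : graph_class) (k : nat -> R), weakly_block_stable A ->
     (forall (n : nat) (G : graph 'I_n),
        G \in graphs_on A n -> #|blocks G|%:R <= k n) ->
     k @ class_infty A --> +oo ->
     whp R A (fun n G =>
       (diam (block_forest G))%:R <= 5 * Num.sqrt (k n * ln (k n)))).
Proof.
split; [|split].
- move=> A stA; apply: (whp_diam (k := fun n => n%:R) stA).
    by move=> n G _; rewrite ler_nat sum_blocks_le_order.
  apply: cvg_within_filter; exact: cvgr_idn.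
- move=> eps e0; have [n0 tail] := tail_linear e0.
  exists (eps ^+ 2 / 16), n0; split; first by rewrite divr_gt0 // exprn_gt0.
  move=> A stA n le_n _; have [m [lt_m tb]] := tail n le_n.
  apply: le_trans tb; apply: class_pr_wide => //.
    by move=> G _; rewrite ler_nat sum_blocks_le_order.
  by move=> G; rewrite -(ltr_nat R); apply: lt_le_trans.
move=> A k stA le_k kinf; apply: whp_diam => // n G GA.
by apply: le_trans (le_k n G GA); rewrite ler_nat sum_blocks_components.
Qed.
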